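(* Let $\mathcal{N}\subset\mathbb{C}$ be a bounded planar domain. Then there exists a complete non-proper holomorphic embedding of $\mathcal{N}$ in $\mathbb{C}^2$.
   Context: A domain is a (non-empty) connected open set. A holomorphic embedding $F:\mathcal{N}\to\mathbb{C}^2$ is complete if the Riemannian metric induced on $\mathcal{N}$ by the Euclidean metric of $\mathbb{C}^2\equiv\mathbb{R}^4$ is complete; it is non-proper if $F:\mathcal{N}\to\mathbb{C}^2$ is not a proper map. *)

(* Defs.v *)
From HB Require Import structures.
From mathcomp Require Import all_boot all_order all_algebra.
From mathcomp Require Import complex.
From mathcomp Require Import all_classical all_reals all_analysis.

Set Implicit Arguments.
Unset Strict Implicit.
Unset Printing Implicit Defensive.

Import Order.TTheory GRing.Theory Num.Theory numFieldNormedType.Exports.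

Local Open Scope classical_set_scope.
Local Open Scope ring_scope.
Local Open Scope complex_scope.

(* [R[i]] only carries its topology through the regular module [R[i]^o]; over
   this normed space, [derivable] and [derive1] are complex differentiability
   and the complex derivative. *)
Notation CC R := (R[i]^o) (only parsing).

Definition domain (R : realType) (N : set (CC R)) : Prop :=
  [/\ N !=set0, open N & connected N].

Section Embeddings.
Variable R : realType.
Implicit Types (N : set (CC R)) (F : CC R -> CC R * CC R).

Definition holomorphic_on N F : Prop :=
  forall z, N z -> derivable F z (1 : CC R).

Definition homeomorphic_onto_image N F : Prop :=
  {within N, continuous F} /\
  exists G : CC R * CC R -> CC R,
    (forall z, N z -> G (F z) = z) /\ {within F @` N, continuous G}.

Definition holomorphic_embedding N F : Prop :=
  [/\ holomorphic_on N F,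
      (forall z, N z -> derive1 F z != 0) &
      homeomorphic_onto_image N F].

Definition proper_on N F : Prop :=
  forall K : set (CC R * CC R), compact K -> compact (N `&` F @^-1` K).

End Embeddings.

Section InducedMetric.
Variable R : realType.
Implicit Types (N : set (CC R)) (F : CC R -> CC R * CC R).
Implicit Types (gamma : R -> CC R).

(* The library norm on a product is the max norm, hence this definition. *)
Definition euclidean_norm (w : CC R * CC R) : R :=
  Num.sqrt (Normc.normc w.1 ^+ 2 + Normc.normc w.2 ^+ 2).

(* Norm of the tangent vector [v] at [z] for the pull-back by [F] of the
   Euclidean metric, i.e. the norm of dF_z(v) = v F'(z). *)
Definition induced_norm F (z v : CC R) : R := euclidean_norm (v *: derive1 F z).

Definition velocity gamma (t : R) : CC R :=
  derive1 (@complex.Re R \o gamma) t +i* derive1 (@complex.Im R \o gamma) t.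

(* C^1 up to the endpoints: the velocity on ]a, b[ extends continuously to
   [a, b]. *)
Definition C1_on gamma (a b : R) : Prop :=
  (forall t, t \in `]a, b[ -> derivable (@complex.Re R \o gamma) t 1 /\
                              derivable (@complex.Im R \o gamma) t 1) /\
  exists delta : R -> CC R,
    {within `[a, b], continuous delta} /\
    (forall t, t \in `]a, b[ -> delta t = velocity gamma t).

(* The subdivision is 0 < s_0 < ... < s_k = 1. *)
Definition piecewise_C1 gamma : Prop :=
  {within `[0, 1], continuous gamma} /\
  exists s : seq R,
    [/\ path <%R 0 s, last 0 s = 1 &
        forall i, (i < size s)%N -> C1_on gamma (nth 0 (0 :: s) i) (nth 0 s i)].

Definition path_in N (p q : CC R) gamma : Prop :=
  [/\ piecewise_C1 gamma,
      (forall t, t \in `[0, 1] -> N (gamma t)), gamma 0 = p & gamma 1 = q].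

(* The finitely many break points, where [velocity] is a junk value, are
   Lebesgue-negligible. *)
Definition induced_length F gamma : \bar R :=
  (\int[lebesgue_measure]_(t in `[0%R, 1%R])
     (induced_norm F (gamma t) (velocity gamma t))%:E)%E.

Definition induced_dist N F (p q : CC R) : \bar R :=
  ereal_inf [set induced_length F gamma | gamma in path_in N p q].

Definition complete_on N F : Prop :=
  forall u : nat -> CC R, (forall n, N (u n)) ->
    (forall e : R, 0 < e -> exists M : nat, forall m n : nat,
       (M <= m)%N -> (M <= n)%N -> (induced_dist N F (u m) (u n) < e%:E)%E) ->
    exists2 p, N p & induced_dist N F (u n) p @[n --> \oo] --> 0%E.

End InducedMetric.

(* Main.v *)
Require Import Defs.
From mathcomp Require Import all_boot all_order all_algebra.
From mathcomp Require Import complex.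
From mathcomp Require Import all_classical all_reals all_analysis.
From mathcomp Require Import measurable_realfun ring lra.

(* The embedding is a graph z |-> (z, f z), for which only completeness and
   non-properness are at stake.  It suffices to find f holomorphic on N which is
   unbounded on every path running to the boundary, yet bounded along some
   sequence tending to it: a path of small induced length has small oscillation
   of f.

   f is a sum of terms (p / (z - a)) ^ m with a outside N.  At scale r take
   finitely many such a, |p| = r/8 and rapidly growing exponents m = 2 ^ k:
   the terms are negligible at distance >= r from the boundary and huge on the
   discs |z - a| <= r/16, which cover the shell {dist = r/64}.  On the thin
   annulus where a new term h is comparable with the sum g of the previous ones,
   |g + h| can be small only where h is close to -g; as arg h turns very fast,
   this happens on tiny islands, so the sublevel set {|g + h| < C} has no
   connected subset crossing the shell.  One more pole term per scale makes f
   vanish at a chosen point near the boundary. *)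

Set Implicit Arguments.
Unset Strict Implicit.
Unset Printing Implicit Defensive.

Import Order.TTheory GRing.Theory Num.Theory numFieldNormedType.Exports.

Local Open Scope classical_set_scope.
Local Open Scope ring_scope.
Local Open Scope complex_scope.

(** * The real-valued modulus and the neighbourhoods it describes *)

Section ComplexModulus.
Variable R : realType.
Implicit Types (z w : CC R).

(** The norm of [R[i]] is itself complex-valued; a modulus in [R] allows ordinary real order
    reasoning. *)
Definition cmod (z : CC R) : R := Normc.normc z.

Lemma normE z : `|z| = (cmod z)%:C.
Proof. by rewrite /cmod normc_def; case: z. Qed.

Lemma cmod_ge0 z : 0 <= cmod z.
Proof. by rewrite /cmod; case: z => a b; rewrite /= sqrtr_ge0. Qed.

Lemma cmod0 : cmod 0 = 0.
Proof. exact: Normc.normc0. Qed.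

Lemma cmod1 : cmod 1 = 1.
Proof. exact: Normc.normc1. Qed.

Lemma cmod_eq0 z : (cmod z == 0) = (z == 0).
Proof.
by apply/eqP/eqP => [/Normc.eq0_normc//|->]; rewrite cmod0.
Qed.

Lemma cmod_gt0 z : (0 < cmod z) = (z != 0).
Proof. by rewrite lt_def cmod_ge0 andbT cmod_eq0. Qed.

Lemma cmodM z w : cmod (z * w) = cmod z * cmod w.
Proof. exact: Normc.normcM. Qed.

Lemma cmodV z : cmod z^-1 = (cmod z)^-1.
Proof. exact: Normc.normcV. Qed.

Lemma cmodX z n : cmod (z ^+ n) = cmod z ^+ n.
Proof. by elim: n => [|n IH]; rewrite ?expr0 ?cmod1// !exprS cmodM IH. Qed.

Lemma cmodN z : cmod (- z) = cmod z.
Proof. exact: normcN. Qed.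

Lemma cmodD z w : cmod (z + w) <= cmod z + cmod w.
Proof. exact: le_normcD. Qed.

Lemma cmod_distC z w : cmod (z - w) = cmod (w - z).
Proof. by rewrite -cmodN opprB. Qed.

Lemma cmod_tri z w u : cmod (z - u) <= cmod (z - w) + cmod (w - u).
Proof. by rewrite (le_trans _ (cmodD _ _))// addrA subrK. Qed.

Lemma cmod_subD z w : cmod z <= cmod w + cmod (z - w).
Proof. by rewrite (le_trans _ (cmodD _ _))// addrC subrK. Qed.

Lemma cmodR (x : R) : cmod x%:C = `|x|.
Proof. by rewrite /cmod/= expr0n addr0 sqrtr_sqr. Qed.

Lemma ReB z w : complex.Re (z - w) = complex.Re z - complex.Re w.
Proof. by case: z w => [a b] [c d]. Qed.

Lemma ImB z w : complex.Im (z - w) = complex.Im z - complex.Im w.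
Proof. by case: z w => [a b] [c d]. Qed.

Lemma Re_le_cmod z : `|complex.Re z| <= cmod z.
Proof.
case: z => a b /=; rewrite /cmod/= -sqrtr_sqr ler_sqrt ?addr_ge0 ?sqr_ge0//.
by rewrite lerDl sqr_ge0.
Qed.

Lemma Im_le_cmod z : `|complex.Im z| <= cmod z.
Proof.
case: z => a b /=; rewrite /cmod/= -sqrtr_sqr ler_sqrt ?addr_ge0 ?sqr_ge0//.
by rewrite lerDr sqr_ge0.
Qed.

Lemma cmod_le_ReIm z : cmod z <= `|complex.Re z| + `|complex.Im z|.
Proof.
case: z => a b /=; rewrite /cmod/=.
rewrite -(ler_pXn2r (n := 2)) ?nnegrE ?sqrtr_ge0 ?addr_ge0//.
rewrite sqr_sqrtr ?addr_ge0 ?sqr_ge0// sqrrD !real_normK ?num_real//.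
by rewrite addrAC lerDl mulrn_wge0// mulr_ge0.
Qed.

Lemma near_cmodP z (P : set (CC R)) :
  nbhs z P <-> exists2 e : R, 0 < e & forall w, cmod (w - z) < e -> P w.
Proof.
split.
  move=> /nbhs_ballP[e /= e0 H].
  (* Radii of balls are complex numbers here; a positive one is real. *)
  have eE : e = (complex.Re e)%:C by rewrite RRe_real// gtr0_real.
  exists (complex.Re e); first by move: e0; rewrite eE ltcR.
  by move=> w we; apply: H; rewrite -ball_normE /= normE eE ltcR cmod_distC.
move=> [e e0 H]; apply/nbhs_ballP; exists e%:C => /=; first by rewrite ltcR.
by move=> w /=; rewrite -ball_normE /= normE ltcR cmod_distC => /H.
Qed.

End ComplexModulus.

Arguments cmod {R} z : simpl never.

(** * Distance to the complement of the domain *)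

Section BoundaryDistance.
Variable R : realType.
Implicit Types (N : set (CC R)) (z w : CC R).

(** For a nonempty complement this is 1-Lipschitz on the whole plane, zero outside [N], and positive
    on [N] when [N] is open. *)
Definition bdist N z : R := inf [set cmod (z - a) | a in ~` N].

Variable N : set (CC R).
Hypothesis NC : ~` N !=set0.

Let has_inf_bdist z : has_inf [set cmod (z - a) | a in ~` N].
Proof.
split; first by case: NC => a Na; exists (cmod (z - a)), a.
by exists 0 => _ [a _ <-]; exact: cmod_ge0.
Qed.

Lemma bdist_le z a : ~ N a -> bdist N z <= cmod (z - a).
Proof. by move=> Na; apply: ge_inf; [case: (has_inf_bdist z)|exists a]. Qed.

Lemma bdist_ge z r : (forall a, ~ N a -> r <= cmod (z - a)) -> r <= bdist N z.
Proof.
move=> H; apply: lb_le_inf; first by case: (has_inf_bdist z).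
by move=> _ [a Na <-]; exact: H.
Qed.

Lemma bdist_lip z w : bdist N z <= bdist N w + cmod (z - w).
Proof.
rewrite -lerBlDr; apply: bdist_ge => a Na; rewrite lerBlDr.
by rewrite (le_trans (bdist_le z Na))// [leRHS]addrC cmod_tri.
Qed.

Lemma bdist_lt z r : bdist N z < r -> exists2 a, ~ N a & cmod (z - a) < r.
Proof.
move=> zr; apply/not_exists2P => H; move: zr; rewrite ltNge => /negP; apply.
apply: bdist_ge => a Na; rewrite leNgt; apply/negP => ar.
by case: (H a).
Qed.

Lemma bdist_ge0 z : 0 <= bdist N z.
Proof. by apply: bdist_ge => a _; exact: cmod_ge0. Qed.

Lemma bdist_gt0 z : open N -> N z -> 0 < bdist N z.
Proof.
move=> oN Nz; have /near_cmodP[e e0 H] : nbhs z N by exact: open_nbhs_nbhs.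
rewrite (lt_le_trans e0)//; apply: bdist_ge => a Na; rewrite leNgt.
by apply/negP => ae; apply: Na; apply: H; rewrite cmod_distC.
Qed.

Lemma bdist_gt0_in z : 0 < bdist N z -> N z.
Proof.
move=> z0; apply: contrapT => Nz; move: (bdist_le z Nz).
by rewrite subrr cmod0 leNgt z0.
Qed.

End BoundaryDistance.

(** * Quantitative differentiability and pole terms *)

Section TamePairs.
Variable R : realType.
Implicit Types (K : set (CC R)) (g h : CC R -> CC R) (M : R).

(* [g'] is the derivative of [g], in a quantitative form that passes to sums
   and to pointwise limits. *)
Definition tame_on K g g' M : Prop := forall z w, K z -> K w ->
  [/\ cmod (g z) <= M, cmod (g' z) <= M &
      cmod (g z - g w - g' w * (z - w)) <= M * cmod (z - w) ^+ 2].

Lemma tame_on_sub K K' g g' M M' :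
  K' `<=` K -> M <= M' -> tame_on K g g' M -> tame_on K' g g' M'.
Proof.
move=> sK leM T z w /sK Kz /sK Kw; case: (T _ _ Kz Kw) => H1 H2 H3.
split; [exact: le_trans leM|exact: le_trans leM|].
by rewrite (le_trans H3)// ler_wpM2r// sqr_ge0.
Qed.

Lemma tame_onD K g g' M h h' M' :
  tame_on K g g' M -> tame_on K h h' M' ->
  tame_on K (fun z => g z + h z) (fun z => g' z + h' z) (M + M').
Proof.
move=> T T' z w Kz Kw.
case: (T _ _ Kz Kw) (T' _ _ Kz Kw) => [H1 H2 H3] [J1 J2 J3].
split; rewrite /=; [by rewrite (le_trans (cmodD _ _))// lerD..|].
have -> : g z + h z - (g w + h w) - (g' w + h' w) * (z - w) =
  (g z - g w - g' w * (z - w)) + (h z - h w - h' w * (z - w)) by ring.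
by rewrite (le_trans (cmodD _ _))// mulrDl lerD.
Qed.

Lemma tame_on0 K : tame_on K (fun=> 0) (fun=> 0) 0.
Proof.
by move=> z w _ _; split; rewrite /= ?mul0r ?subr0 ?cmod0 ?mul0r.
Qed.

Lemma tame_on_lip K g g' M z w : tame_on K g g' M -> K z -> K w ->
  cmod (z - w) <= 1 -> cmod (g z - g w) <= 2 * M * cmod (z - w).
Proof.
move=> T Kz Kw zw1; case: (T _ _ Kw Kz) => _ H2 _.
case: (T _ _ Kz Kw) => H1 _ H3.
have M0 : 0 <= M by exact: le_trans (cmod_ge0 _) H1.
have X0 := cmod_ge0 (z - w).
rewrite (le_trans (cmod_subD _ (g' w * (z - w))))// cmodM.
have : cmod (g' w) * cmod (z - w) <= M * cmod (z - w) by rewrite ler_wpM2r.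
have : M * cmod (z - w) ^+ 2 <= M * cmod (z - w).
  by rewrite ler_wpM2l// expr2 ler_piMr.
by move: H3; nra.
Qed.

(** Adding the expansions of [g] at [w] and at [z] cancels the values of [g] and leaves (g' z - g'
    w) (z - w), so no second derivative is needed. *)
Lemma tame_on_deriv_lip K g g' M z w : tame_on K g g' M -> K z -> K w ->
  cmod (g' z - g' w) <= 2 * M * cmod (z - w).
Proof.
move=> T Kz Kw; have [->|zw] := eqVneq z w.
  by rewrite !subrr !cmod0 mulr0.
case: (T _ _ Kw Kz) => _ _ H1; case: (T _ _ Kz Kw) => _ _ H2.
have zw0 : 0 < cmod (z - w) by rewrite cmod_gt0 subr_eq0.
rewrite -(ler_pM2r zw0) -cmodM.
have -> : (g' z - g' w) * (z - w) = (g z - g w - g' w * (z - w)) +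
  (g w - g z - g' z * (w - z)) by ring.
rewrite (le_trans (cmodD _ _))//.
by move: H1 H2; rewrite (cmod_distC w z); nra.
Qed.

(** For large [m] the term is tiny where |z - a| exceeds |p| by a fixed factor, and huge where |z -
    a| falls short of |p| by one. *)
Definition pole (a p : CC R) m (z : CC R) : CC R := (p / (z - a)) ^+ m.
Definition dpole (a p : CC R) m (z : CC R) : CC R :=
  - (m%:R * (p / (z - a)) ^+ m / (z - a)).

(** To be read with x = p / (z - a), y = p / (w - a), q = 1 / (w - a) and D = z - w. The relation
    between [x] and [y] is all that the induction on [m] uses, so no division occurs in it. *)
Let pow_lip (x y q D : CC R) (k s X : R) m :
  x - y = - (x * q * D) -> cmod x <= k -> cmod y <= k -> cmod q <= s ->
  cmod D = X ->
  cmod (x ^+ m - y ^+ m) <= m%:R * k ^+ m * s * X.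
Proof.
move=> xy xk yk qs DX.
have k0 : 0 <= k by exact: le_trans (cmod_ge0 _) xk.
have s0 : 0 <= s by exact: le_trans (cmod_ge0 _) qs.
have X0 : 0 <= X by rewrite -DX cmod_ge0.
elim: m => [|m IH]; first by rewrite !expr0 subrr cmod0 !mul0r.
have -> : x ^+ m.+1 - y ^+ m.+1 = x * (x ^+ m - y ^+ m) - y ^+ m * (x * q * D).
  have -> : x * q * D = y - x by rewrite -opprB xy opprK.
  by rewrite !exprS; ring.
rewrite (le_trans (cmodD _ _))// cmodN !cmodM cmodX DX.
have -> : m.+1%:R * k ^+ m.+1 * s * X =
  k * (m%:R * k ^+ m * s * X) + k ^+ m * (k * s * X).
  by rewrite exprS -natr1; ring.
apply: lerD; first by apply: ler_pM => //; exact: cmod_ge0.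
apply: ler_pM; rewrite ?exprn_ge0 ?cmod_ge0 ?mulr_ge0 ?cmod_ge0//.
  by rewrite lerXn2r ?nnegrE ?cmod_ge0.
by rewrite ler_wpM2r// ler_pM// cmod_ge0.
Qed.

(** The second-order remainder at m + 1 is [y] times the one at [m] minus q D (x^(m+1) - y^(m+1)),
    and the last factor is bounded by [pow_lip]. *)
Let pow_lip2 (x y q D : CC R) (k s X : R) m :
  x - y = - (x * q * D) -> cmod x <= k -> cmod y <= k -> cmod q <= s ->
  cmod D = X ->
  cmod (x ^+ m - y ^+ m + m%:R * y ^+ m * q * D) <=
  m%:R ^+ 2 * k ^+ m * s ^+ 2 * X ^+ 2.
Proof.
move=> xy xk yk qs DX.
have k0 : 0 <= k by exact: le_trans (cmod_ge0 _) xk.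
have s0 : 0 <= s by exact: le_trans (cmod_ge0 _) qs.
have X0 : 0 <= X by rewrite -DX cmod_ge0.
elim: m => [|m IH].
  by rewrite !expr0 subrr !mul0r addr0 cmod0 ?expr0n ?mul0r.
have -> : x ^+ m.+1 - y ^+ m.+1 + m.+1%:R * y ^+ m.+1 * q * D =
  y * (x ^+ m - y ^+ m + m%:R * y ^+ m * q * D) -
  q * D * (x ^+ m.+1 - y ^+ m.+1).
  transitivity (y * (x ^+ m - y ^+ m + m%:R * y ^+ m * q * D) +
    (x - y) * x ^+ m + y ^+ m.+1 * q * D).
    by rewrite !exprS -natr1; ring.
  by rewrite xy !exprS; ring.
have {}IH := ler_pM (cmod_ge0 _) (cmod_ge0 _) yk IH.
have := pow_lip m.+1 xy xk yk qs DX.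
move=> /(ler_pM (cmod_ge0 _) (cmod_ge0 _) qs) H.
have {}H := ler_wpM2l X0 H.
rewrite (le_trans (cmodD _ _))// cmodN !cmodM DX.
apply: (@le_trans _ _ (k * (m%:R ^+ 2 * k ^+ m * s ^+ 2 * X ^+ 2) +
   X * (s * (m.+1%:R * k ^+ m.+1 * s * X)))).
  by rewrite lerD// [cmod q * X]mulrC -[leLHS]mulrA.
have P0 : 0 <= k ^+ m.+1 * s ^+ 2 * X ^+ 2.
  by rewrite !mulr_ge0 ?exprn_ge0.
(* The slack is (m + 1)^2 - m^2 - (m + 1) = m times a nonnegative factor. *)
rewrite -subr_ge0.
have -> : m.+1%:R ^+ 2 * k ^+ m.+1 * s ^+ 2 * X ^+ 2 -
  (k * (m%:R ^+ 2 * k ^+ m * s ^+ 2 * X ^+ 2) +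
   X * (s * (m.+1%:R * k ^+ m.+1 * s * X))) =
  m%:R * (k ^+ m.+1 * s ^+ 2 * X ^+ 2).
  by rewrite [k ^+ m.+1]exprS -natr1; ring.
by rewrite mulr_ge0.
Qed.

(** One constant dominates the three natural bounds k^m, m k^m / r and m^2 k^m / r^2. Its factor k^m
    makes it negligible for large [m] when k < 1. *)
Lemma pole_tame K (a p c : CC R) (r k : R) m :
  0 < r -> cmod p <= k * r -> (forall z, K z -> r <= cmod (z - a)) ->
  tame_on K (fun z => c * pole a p m z) (fun z => c * dpole a p m z)
    (cmod c * ((1 + m%:R ^+ 2) * k ^+ m * (1 + r^-1) ^+ 2)).
Proof.
move=> r0 pk HK z w Kz Kw.
have r'0 : 0 < r^-1 by rewrite invr_gt0.
have k0 : 0 <= k.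
  by rewrite -(pmulr_lge0 _ r0) (le_trans _ pk)// cmod_ge0.
have ne u : K u -> u - a != 0.
  by move=> /HK H; rewrite -cmod_gt0 (lt_le_trans r0).
have inv u : K u -> cmod (u - a)^-1 <= r^-1.
  by move=> Ku; rewrite cmodV lef_pV2 ?posrE ?cmod_gt0 ?ne// HK.
have bd u : K u -> cmod (p / (u - a)) <= k.
  move=> Ku; rewrite cmodM (le_trans (ler_pM _ _ pk (inv _ Ku)))// ?cmod_ge0//.
  by rewrite mulfK// gt_eqF.
have km0 : 0 <= k ^+ m by rewrite exprn_ge0.
have bdX u : K u -> cmod ((p / (u - a)) ^+ m) <= k ^+ m.
  by move=> Ku; rewrite cmodX lerXn2r ?nnegrE ?cmod_ge0 ?bd.
have m0 : 0 <= m%:R :> R by [].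
have cmodn : cmod (m%:R : CC R) = m%:R.
  have -> : (m%:R : CC R) = (m%:R : R)%:C by rewrite rmorph_nat.
  by rewrite cmodR ger0_norm.
have le1 (x : R) : x <= 1 + x ^+ 2 by have := sqr_ge0 (x - 2^-1); nra.
have le2 (x : R) : 0 < x -> x <= (1 + x) ^+ 2 by nra.
split.
- rewrite cmodM ler_wpM2l ?cmod_ge0// (le_trans (bdX _ Kz))//.
  have -> : (1 + m%:R ^+ 2) * k ^+ m * (1 + r^-1) ^+ 2 =
    k ^+ m * ((1 + m%:R ^+ 2) * (1 + r^-1) ^+ 2) by ring.
  by rewrite ler_peMr// mulr_ege1// ?exprn_ege1// lerDl ?sqr_ge0// ltW.
- rewrite cmodM ler_wpM2l ?cmod_ge0// /dpole cmodN !cmodM cmodn.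
  apply: (@le_trans _ _ (m%:R * k ^+ m * r^-1)).
    by rewrite ler_pM ?mulr_ge0 ?cmod_ge0 ?inv// ler_wpM2l ?bdX.
  have -> : (1 + m%:R ^+ 2) * k ^+ m * (1 + r^-1) ^+ 2 =
    k ^+ m * ((1 + m%:R ^+ 2) * (1 + r^-1) ^+ 2) by ring.
  have -> : m%:R * k ^+ m * r^-1 = k ^+ m * (m%:R * r^-1) by ring.
  by rewrite ler_wpM2l// ler_pM ?le1 ?le2// ltW.
- have -> : c * pole a p m z - c * pole a p m w - c * dpole a p m w * (z - w) =
    c * ((p / (z - a)) ^+ m - (p / (w - a)) ^+ m +
         m%:R * (p / (w - a)) ^+ m * (w - a)^-1 * (z - w)).
    by rewrite /pole /dpole; ring.
  rewrite cmodM -[leRHS]mulrA ler_wpM2l ?cmod_ge0//.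
  have xy : p / (z - a) - p / (w - a) = - (p / (z - a) * (w - a)^-1 * (z - w)).
    by field; rewrite !ne.
  have := pow_lip2 m xy (bd _ Kz) (bd _ Kw) (inv _ Kw) erefl.
  move=> /le_trans; apply; rewrite ler_wpM2r ?sqr_ge0//.
  have -> : (1 + m%:R ^+ 2) * k ^+ m * (1 + r^-1) ^+ 2 =
    k ^+ m * ((1 + m%:R ^+ 2) * (1 + r^-1) ^+ 2) by ring.
  have -> : m%:R ^+ 2 * k ^+ m * r^-1 ^+ 2 = k ^+ m * (m%:R ^+ 2 * r^-1 ^+ 2).
    by ring.
  rewrite ler_wpM2l// ler_pM ?sqr_ge0// ?lerDr//.
  by rewrite lerXn2r ?nnegrE ?addr_ge0 ?lerDr// ltW.
Qed.

End TamePairs.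

(** The trace of [A] on [S] is open and closed relative to [S]. Only points of [S] are tested, so
    [A] may be neither open nor closed in the ambient space. *)
Lemma connected_near (T : topologicalType) (S A : set T) :
  connected S -> S `&` A !=set0 ->
  (forall z, S z -> A z -> \forall w \near z, S w -> A w) ->
  (forall z, S z -> ~ A z -> \forall w \near z, S w -> ~ A w) -> S `<=` A.
Proof.
move=> cS SA0 HA HnA.
suff <- : S `&` A = S by move=> z [].
apply: cS => //.
  exists (interior [set w | S w -> A w]); first exact: open_interior.
  apply/seteqP; split => z [Sz].
    by move=> Az; split => //; exact: HA.
  by move=> /interior_subset/(_ Sz).
exists (~` interior [set w | S w -> ~ A w]).
  by apply: open_closedC; exact: open_interior.
apply/seteqP; split => z [Sz].
  by move=> Az; split => // /interior_subset/(_ Sz).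
by move=> nI; split => //; apply: contrapT => nAz; apply: nI; exact: HnA.
Qed.

(** * Continuity of the elementary functions of the plane *)

Section Connectedness.
Variable R : realType.
Implicit Types (z w : CC R).

Lemma short_continuous (f : CC R -> R) :
  (forall z w, f z <= f w + cmod (z - w)) -> continuous f.
Proof.
move=> H z P /nbhs_ballP[e /= e0 HP]; apply/near_cmodP; exists e => // w wz.
apply: HP; rewrite -ball_normE /= (le_lt_trans _ wz)// ler_distl.
have := H z w; have := H w z.
by rewrite (cmod_distC z w) => H1 H2; apply/andP; split; lra.
Qed.

Lemma Re_continuous : continuous (@complex.Re R : CC R -> R).
Proof.
apply: short_continuous => z w.
by rewrite -lerBlDl -ReB (le_trans (ler_norm _))// Re_le_cmod.
Qed.

Lemma cmodB_continuous z0 : continuous (fun z : CC R => cmod (z - z0)).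
Proof. by apply: short_continuous => z w; rewrite [leRHS]addrC cmod_tri. Qed.

Lemma bdist_continuous N : ~` N !=set0 -> continuous (@bdist R N).
Proof. by move=> NC; apply: short_continuous; exact: bdist_lip. Qed.

Lemma ratio_continuous (c a z : CC R) n : z != a ->
  {for z, continuous (fun u : CC R => (c / (u - a)) ^+ n : CC R)}.
Proof.
move=> za; have H : {for z, continuous (fun u : CC R => c / (u - a) : CC R)}.
  have H1 : {for z, continuous (fun u : CC R => u - a : CC R)}.
    by apply: (@cvgB _ _ _ (nbhs z)); [exact: cvg_id|exact: cvg_cst].
  apply: (@cvgM _ _ (nbhs z)); first exact: cvg_cst.
  by apply: (@cvgV _ _ (nbhs z)) H1; rewrite subr_eq0.
elim: n => [|n IH].
  rewrite (_ : (fun u : CC R => _) = cst 1); last first.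
    by apply/funext => u; rewrite expr0.
  exact: (@cvg_cst _ _ _ (nbhs z)).
have -> : (fun u : CC R => (c / (u - a)) ^+ n.+1) =
    (fun u => c / (u - a) * (c / (u - a)) ^+ n).
  by apply/funext => u; rewrite exprS.
exact: (@cvgM _ _ (nbhs z) _ _ _ _ _ H IH).
Qed.

End Connectedness.

(** * Iterated principal square roots near 1 *)

Section RootBranch.
Variable R : realType.
Implicit Types (z w v : CC R).

(** Factor v^2 - 1 = (v - 1) (v + 1): the sign condition selects the root near 1, where |v + 1| >=
    3/2. *)
Lemma sqrt_contract v : 0 <= complex.Re v -> cmod (v ^+ 2 - 1) <= 2^-1 ->
  cmod (v - 1) <= 2 / 3 * cmod (v ^+ 2 - 1).
Proof.
move=> v0 H.
(* With v = a + ib, the real part gives a^2 - b^2 >= 1/2, hence a >= 1/2. *)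
have v2 : 2^-1 <= complex.Re v.
  have : `|complex.Re (v ^+ 2 - 1)| <= 2^-1 by exact: le_trans (Re_le_cmod _) H.
  case: v v0 {H} => a b; rewrite expr2 /= => a0; rewrite ler_norml => /andP[+ _].
  by have := sqr_ge0 b; nra.
have v1 : 3 / 2 <= cmod (v + 1).
  have := Re_le_cmod (v + 1); case: v {v0 H} v2 => a b /= a2.
  by move/(le_trans (ler_norm _)); lra.
have -> : v ^+ 2 - 1 = (v - 1) * (v + 1) by ring.
by rewrite cmodM; have := cmod_ge0 (v - 1); nra.
Qed.

(** Each square root contracts the distance to 1 by 2/3. Weak inequalities on the real parts are
    improved to strict ones, which is what lets the sign conditions propagate along a connected
    set. *)
Lemma iter_sqrt_contract k w :
  (forall j, (j < k)%N -> 0 <= complex.Re (w ^+ (2 ^ j))) ->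
  cmod (w ^+ (2 ^ k) - 1) <= 2^-1 ->
  cmod (w - 1) <= (2 / 3) ^+ k / 2 /\
  forall j, (j < k)%N -> 0 < complex.Re (w ^+ (2 ^ j)).
Proof.
elim: k w => [|k IH] w H; first by rewrite expn0 !expr1 expr0 mul1r.
rewrite expnS exprM => /IH[].
  by move=> j jk; rewrite -exprM -expnS; exact: H.
move=> H1 H2.
have k1 : (2 / 3) ^+ k / 2 <= 2^-1 :> R.
  by rewrite ler_piMl// exprn_ile1//; lra.
have := sqrt_contract (H 0%N isT); rewrite expn0 expr1 => /(_ (le_trans H1 k1)) H3.
have H4 : cmod (w - 1) <= (2 / 3) ^+ k.+1 / 2.
  by rewrite (le_trans H3)// [(2 / 3) ^+ k.+1]exprS -[leRHS]mulrA ler_wpM2l.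
split => // -[_|j jk]; last by rewrite expnS exprM; exact: H2.
rewrite expn0 expr1.
have : `|complex.Re (w - 1)| <= 2^-1.
  rewrite (le_trans (Re_le_cmod _))// (le_trans H4)// ler_piMl// exprn_ile1//; lra.
by case: w {H H1 H2 H3 H4} => a b /=; rewrite ler_norml => /andP[]; lra.
Qed.

End RootBranch.

(** * A single pole traps connected sets where the sum stays small *)

Section Barrier.
Variable R : realType.
Implicit Types (z w : CC R).

(* With [w = (z0 - a) / (z - a)], the pole term at [z] is [w ^+ m] times its
   value at [z0]. While [z] is near [z0], [g] is nearly constant, so
   [w ^+ m] stays near [1]; taking square roots [k] times along the connected
   set [S] forces [w] itself to stay very close to [1]. *)
Lemma pole_traps (S : set (CC R)) (g : CC R -> CC R) (a p z0 : CC R) k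
    (C tau B : R) :
  connected S -> S z0 -> 0 < tau -> ~ S a ->
  (forall z, S z -> cmod (z - a) <= B) ->
  (forall z, S z -> cmod (z - z0) <= tau -> cmod (g z - g z0) < C) ->
  8 * C <= cmod (g z0) ->
  (forall z, S z -> cmod (g z + pole a p (2 ^ k) z) < C) ->
  (2 / 3) ^+ k * B < tau ->
  forall z, S z -> cmod (z - z0) < tau.
Proof.
move=> cS Sz0 tau0 Sa HB Hg Hg0 Hh kB.
pose m := (2 ^ k)%N; pose w z := (z0 - a) / (z - a).
have ne z : S z -> z - a != 0.
  by move=> Sz; rewrite subr_eq0; apply/eqP => za; apply: Sa; rewrite -za.
have C0 : 0 < C by apply: le_lt_trans (cmod_ge0 _) (Hh _ Sz0).
have hz0 : 7 * C <= cmod (pole a p m z0).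
  have := Hh _ Sz0; have := cmodD (g z0 + pole a p m z0) (- pole a p m z0).
  by rewrite addrK cmodN; rewrite -/m; lra.
(* The pole term varies by less than 3C: twice [C] from the two sums, once from [g]. It is at least
   7C in modulus at [z0], and 3/7 <= 1/2; the factor 8 is chosen for this. *)
have wm z : S z -> cmod (z - z0) <= tau -> cmod (w z ^+ m - 1) <= 2^-1.
  move=> Sz zt; have h0 : 0 < cmod (pole a p m z0) by lra.
  have E : pole a p m z - pole a p m z0 = pole a p m z0 * (w z ^+ m - 1).
    rewrite mulrBr mulr1 /pole -exprMn /w; congr (_ ^+ _ - _).
    by field; rewrite !ne.
  rewrite -(ler_pM2l h0) -cmodM -E.
  have -> : pole a p m z - pole a p m z0 =
     (g z + pole a p m z) - (g z0 + pole a p m z0) - (g z - g z0) by ring.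
  have := cmodD (g z + pole a p m z - (g z0 + pole a p m z0)) (- (g z - g z0)).
  have := cmodD (g z + pole a p m z) (- (g z0 + pole a p m z0)).
  rewrite !cmodN; have := Hg _ Sz zt; have := Hh _ Sz; have := Hh _ Sz0.
  by rewrite -/m; lra.
have close z : S z -> cmod (w z - 1) <= (2 / 3) ^+ k / 2 ->
    cmod (z - z0) < tau.
  move=> Sz wz; have -> : z - z0 = - ((z - a) * (w z - 1)).
    by rewrite /w; field; rewrite ne.
  rewrite cmodN cmodM.
  have B0 : 0 <= B by exact: le_trans (cmod_ge0 _) (HB _ Sz).
  have P0 : 0 <= (2 / 3) ^+ k :> R by rewrite exprn_ge0//; lra.
  apply: (@le_lt_trans _ _ (B * ((2 / 3) ^+ k / 2))).
    by apply: ler_pM; rewrite ?cmod_ge0// HB.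
  by apply: le_lt_trans kB; nra.
(* The strict conditions say that [w z] is the iterated principal root of [w z ^+ m]. They are open;
   the complement in [S] is shown to be open too. *)
pose A z := cmod (z - z0) < tau /\
  forall j : 'I_k, 0 < complex.Re (w z ^+ (2 ^ j)).
suff : S `<=` A by move=> SA z /SA[].
have cw n z : S z -> {for z, continuous (fun u => complex.Re (w u ^+ n))}.
  move=> Sz; apply: (@continuous_comp _ _ _ (fun u : CC R => w u ^+ n : CC R)
    (@complex.Re R)); last exact: Re_continuous.
  by apply: ratio_continuous; rewrite -subr_eq0 ne.
apply: connected_near => //.
- exists z0; split => //; split; first by rewrite subrr cmod0.
  by move=> j; rewrite /w divff ?ne// expr1n.
- move=> z Sz [zt Hj].
  have N1 : \forall u \near z, cmod (u - z0) < tau.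
    exact: (cvgr_lt _ (@cmodB_continuous R z0 z)).
  have N2 : \forall u \near z, forall j : 'I_k, 0 < complex.Re (w u ^+ (2 ^ j)).
    apply: (@filter_forall _ _ _ (nbhs z)) => j.
    exact: (@cvgr_gt _ _ (nbhs z) _ _ _ (cw _ _ Sz) _ (Hj j)).
  by near=> u; move=> _; split; near: u.
- move=> z Sz nA.
  have [zt|zt] := ltP tau (cmod (z - z0)).
    have : \forall u \near z, tau < cmod (u - z0).
      exact: (cvgr_gt _ (@cmodB_continuous R z0 z)).
    apply: filterS => u ut _ [].
    by rewrite ltNge ltW.
  (* Were all these real parts nonnegative, the contraction would make them positive and put [z]
     strictly inside the disc, hence in [A]. *)
  have [j Hj] : exists j : 'I_k, complex.Re (w z ^+ (2 ^ j)) < 0.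
    apply: contrapT => /forallNP H; apply: nA.
    have H' j : (j < k)%N -> 0 <= complex.Re (w z ^+ (2 ^ j)).
      by move=> jk; rewrite leNgt; apply/negP; exact: (H (Ordinal jk)).
    have [/(close _ Sz) H1 H2] := iter_sqrt_contract H' (wm _ Sz zt).
    by split => // j; exact: H2.
  have : \forall u \near z, complex.Re (w u ^+ (2 ^ j)) < 0.
    exact: (cvgr_lt _ (cw _ _ Sz)).
  by apply: filterS => u u0 _ [_ /(_ j)]; rewrite ltNge ltW.
Unshelve. all: by end_near. Qed.

End Barrier.

(** * Decay estimates and finite nets *)

Section Estimates.
Variable R : realType.
Implicit Types (q X e s : R).

Lemma geometric_small q X e : 0 <= q < 1 -> 0 < e ->
  exists n0, forall n, (n0 <= n)%N -> q ^+ n * X < e.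
Proof.
move=> /andP[q0 q1] e0.
have X1 : 0 < `|X| + 1 by rewrite ltr_wpDl.
have : \forall n \near \oo, `|q ^+ n| < e / (`|X| + 1).
  have H : (GRing.exp q : R ^nat) @ \oo --> (0 : R).
    by apply: cvg_expr; rewrite ger0_norm.
  have := @cvgr0_norm_lt _ _ _ _ _ _ H (e / (`|X| + 1)).
  by apply; rewrite divr_gt0.
move=> [n0 _ H]; exists n0 => n /= nn; have := H _ nn.
rewrite ger0_norm ?exprn_ge0// ltr_pdivlMr// => /le_lt_trans; apply.
by rewrite ler_wpM2l ?exprn_ge0// (le_trans (ler_norm _))// lerDl.
Qed.

(** Write 8^-m = 2^-m 4^-m: the factor 4^-m absorbs 1 + m^2, and 2^-m still tends to zero. *)
Lemma pole_bound_small X s e : 0 <= X -> 0 < e -> exists n0, forall m,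
  (n0 <= m)%N -> X * ((1 + m%:R ^+ 2) * (1 / 8) ^+ m * (1 + s^-1) ^+ 2) <= e.
Proof.
move=> X0 e0.
have [|n0 H] := @geometric_small (1 / 2) (2 * X * (1 + s^-1) ^+ 2) e _ e0.
  by apply/andP; split; lra.
exists n0 => m nm; apply: le_trans (ltW (H m nm)).
have -> : (1 / 8) ^+ m = (1 / 2) ^+ m * (1 / 4) ^+ m :> R.
  by rewrite -exprMn; congr (_ ^+ m); field.
have Q0 : 0 <= (1 / 2) ^+ m * (X * (1 + s^-1) ^+ 2).
  have h2 : 0 <= 1 / 2 :> R by lra.
  by apply: mulr_ge0; [exact: exprn_ge0|rewrite mulr_ge0 ?sqr_ge0].
suff : (1 + m%:R ^+ 2) * (1 / 4) ^+ m <= 2 :> R by nra.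
have m2 : m%:R ^+ 2 <= 4 ^+ m :> R.
  have -> : 4 ^+ m = (2 ^+ m) ^+ 2 :> R.
    by rewrite -exprM mulnC exprM; congr (_ ^+ m); ring.
  by rewrite lerXn2r ?nnegrE// -natrX ler_nat ltnW// ltn_expl.
have p0 : 0 < 4 ^+ m :> R by rewrite exprn_gt0.
rewrite expr_div_n expr1n mulrA mulr1 ler_pdivrMr//.
suff : 1 <= 4 ^+ m :> R by lra.
by rewrite exprn_ege1// ler1n.
Qed.

(** A square grid of mesh eta / 2: rounding each coordinate down costs at most one mesh. *)
Lemma finite_net (B eta : R) : 0 < eta -> exists l : seq (CC R),
  forall z, cmod z <= B -> exists2 b, b \in l & cmod (z - b) <= eta.
Proof.
move=> eta0; pose d := eta / 2; have d0 : 0 < d by rewrite divr_gt0.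
pose n := (Num.truncn (2 * B / d)).+1.
pose pt (ij : nat * nat) : CC R := (ij.1%:R * d - B) +i* (ij.2%:R * d - B).
exists [seq pt (i, j) | i <- iota 0 n, j <- iota 0 n] => -[x y] zB.
have idx (t : R) : `|t| <= B ->
    exists2 i, i \in iota 0 n & `|t - (i%:R * d - B)| <= d.
  rewrite ler_norml => /andP[t1 t2].
  have u0 : 0 <= (t + B) / d by apply: divr_ge0; [lra|exact: ltW].
  have v0 : 0 <= 2 * B / d by apply: divr_ge0; [lra|exact: ltW].
  exists (Num.truncn ((t + B) / d)).
    rewrite mem_iota add0n /= ltnS truncn_le_nat.
    have /andP[_] := truncn_itv v0.
    by apply: le_lt_trans; rewrite ler_pM2r ?invr_gt0//; lra.
  have /andP[] := truncn_itv u0.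
  set i := Num.truncn _; rewrite ler_pdivlMr// ltr_pdivrMr// => H1.
  rewrite -[i.+1%:R]natr1 mulrDl mul1r => H2.
  by rewrite ler_norml; apply/andP; split; lra.
have [i il Hi] := idx x (le_trans (Re_le_cmod _) zB).
have [j jl Hj] := idx y (le_trans (Im_le_cmod _) zB).
exists (pt (i, j)); first by apply/allpairsP; exists (i, j); split.
rewrite (le_trans (cmod_le_ReIm _))// ReB ImB /=.
by rewrite (le_trans (lerD Hi Hj))// /d; lra.
Qed.

End Estimates.

(** * One stage of the construction, at scale [r] *)

Section Stages.
Variables (R : realType) (N : set (CC R)) (B0 : R).
Hypotheses (NC : ~` N !=set0) (N0 : N !=set0).
Hypothesis NB : forall z, N z -> cmod z <= B0.
Implicit Types (g h : CC R -> CC R) (r e C tau : R).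

Definition far r : set (CC R) := [set z | r <= bdist N z].
(** The sets [far r] exhaust an open [N]; the constant is uniform on each of them but may blow up at
    the boundary. *)
Definition tame g g' : Prop :=
  forall r, 0 < r -> exists M, tame_on (far r) g g' M.

Lemma far_sub r r' : r' <= r -> far r `<=` far r'.
Proof. by move=> rr z; apply: le_trans. Qed.

Lemma far_N r z : 0 < r -> far r z -> N z.
Proof. by move=> r0 fz; apply: (bdist_gt0_in NC); apply: lt_le_trans fz. Qed.

Lemma far_cmod r a z : ~ N a -> far r z -> r <= cmod (z - a).
Proof. by move=> Na fz; rewrite (le_trans fz)// bdist_le. Qed.

Lemma tameD g g' h h' : tame g g' -> tame h h' ->
  tame (fun z => g z + h z) (fun z => g' z + h' z).
Proof.
move=> T T' r r0; have [M HM] := T r r0; have [M' HM'] := T' r r0.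
by exists (M + M'); exact: tame_onD.
Qed.

Lemma tame_pole a p c m : ~ N a ->
  tame (fun z => c * pole a p m z) (fun z => c * dpole a p m z).
Proof.
move=> Na r r0; eexists; apply: (@pole_tame _ _ _ _ _ r (cmod p / r)) => //.
  by rewrite divfK// gt_eqF.
by move=> z; exact: far_cmod Na.
Qed.

(** On [far r] the ratio |p / (z - a)| is at most 1/8, so a high power beats any coefficient [c].
    Exponents are powers of two for the sake of the iterated square roots. *)
Lemma tame_on_pole a p c m0 r e : ~ N a -> 0 < r -> 0 < e ->
  cmod p <= r / 8 -> exists k0, forall k, (k0 <= k)%N ->
  tame_on (far r) (fun z => c * pole a p (2 ^ k) z)
    (fun z => c * dpole a p (2 ^ k) z) e /\ (m0 <= 2 ^ k)%N.
Proof.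
move=> Na r0 e0 pr.
have [n0 H] := pole_bound_small r (cmod_ge0 c) e0.
exists (maxn n0 m0) => k; rewrite geq_max => /andP[nk mk].
have kk : (k <= 2 ^ k)%N by rewrite ltnW// ltn_expl.
split; last exact: leq_trans kk.
have T : tame_on (far r) (fun z => c * pole a p (2 ^ k) z)
    (fun z => c * dpole a p (2 ^ k) z) (cmod c *
    ((1 + (2 ^ k)%:R ^+ 2) * (1 / 8) ^+ (2 ^ k) * (1 + r^-1) ^+ 2)).
  apply: pole_tame => //; last by move=> z; exact: far_cmod Na.
  by rewrite mulrC mulrA mulr1.
exact: (tame_on_sub (@subset_refl _ _) (H _ (leq_trans nk kk)) T).
Qed.

Lemma boundary_net r : 0 < r -> exists l : seq (CC R),
  (forall a, a \in l -> ~ N a) /\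
  forall z, N z -> bdist N z <= r / 32 ->
    exists2 a, a \in l & cmod (z - a) <= r / 16.
Proof.
move=> r0; have [|l Hl] := @finite_net R B0 (r / 96).
  by rewrite divr_gt0.
case: NC => a0 Na0.
(* A point [z] of the shell has a point outside [N] within r/24 = 4r/96 and a net point within r/96,
   hence the 5/96; the final distance is at most 6r/96 = r/16. A net point with no such neighbour
   yields the default [a0], also outside [N]. *)
pose P b := [set a | ~ N a /\ cmod (b - a) <= 5 / 96 * r].
exists [seq xget a0 (P b) | b <- l]; split.
  by move=> _ /mapP[b _ ->]; case: xgetP => [a -> []|//].
move=> z Nz zr; have [b bl zb] := Hl _ (NB Nz).
have [|a Na za] := @bdist_lt _ N NC z (r / 24); first by lra.
exists (xget a0 (P b)); first exact: map_f.
have [_ H] : P b (xget a0 (P b)).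
  apply: (xgetPex a0); exists a; split => //.
  by have := cmod_tri b z a; rewrite (cmod_distC b z); lra.
by have := cmod_tri z b (xget a0 (P b)); lra.
Qed.

(** Otherwise, walking from a point of [N] in one direction by steps e / 2 would never leave [N],
    against boundedness. *)
Lemma near_boundary e : 0 < e -> exists2 p, N p & bdist N p < e.
Proof.
move=> e0; apply: contrapT => /forall2NP H.
case: N0 => z0 Nz0.
have step n : N (z0 + (n%:R * (e / 2))%:C).
  elim: n => [|n IH]; first by rewrite mul0r addr0.
  set z := z0 + _ in IH; case: (H z) => // /negP; rewrite -leNgt => ez.
  apply: (bdist_gt0_in NC).
  set z' := z0 + _.
  have := bdist_lip NC z z'.
  have -> : z - z' = (- (e / 2))%:C.
    by rewrite /z /z' -[n.+1%:R]natr1 mulrDl mul1r !rmorphD rmorphN /=; ring.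
  by rewrite cmodR normrN gtr0_norm ?divr_gt0//; lra.
pose n := (Num.truncn ((B0 + cmod z0) / (e / 2))).+1.
have := NB (step n).
have := cmodD (z0 + (n%:R * (e / 2))%:C) (- z0).
rewrite addrAC subrr add0r cmodN cmodR ger0_norm; last first.
  by rewrite mulr_ge0// divr_ge0// ltW.
have e2 : 0 < e / 2 by rewrite divr_gt0.
have u0 : 0 <= (B0 + cmod z0) / (e / 2).
  apply: divr_ge0; last exact: ltW.
  by rewrite addr_ge0 ?cmod_ge0// (le_trans (cmod_ge0 _) (NB Nz0)).
by have /andP[_] := truncn_itv u0; rewrite ltr_pdivrMr// -/n; lra.
Qed.

(** Poles are added one by one. Where the sum with the new pole stays below [C], either the old sum
    reaches 8C somewhere on [S], and the new pole traps [S] in a small disc, or it stays below 8C on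
    [S], and the induction hypothesis with threshold 8C applies. *)
Lemma barrier_poles (l : seq (CC R)) r r' g g' e C tau :
  0 < r -> 0 < r' -> (forall a, a \in l -> ~ N a) -> tame g g' ->
  0 < e -> 0 < C -> 0 < tau ->
  exists h h', [/\ tame h h', tame_on (far r) h h' e &
    forall S, connected S -> S `<=` far r' ->
      (forall z, S z -> cmod (g z + h z) < C) ->
      (exists2 z0, S z0 & forall z, S z -> cmod (z - z0) < tau) \/
      (forall a, a \in l -> forall z, S z -> r / 16 < cmod (z - a))].
Proof.
move=> r0 r'0 + Tg; elim: l e C => [|a l IH] e C lN e0 C0 tau0.
  exists (fun=> 0), (fun=> 0); split.
  - by move=> s _; exists 0; exact: tame_on0.
  - exact: tame_on_sub (@subset_refl _ _) (ltW e0) (@tame_on0 _ _).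
  - by move=> S _ _ _; right.
have Na : ~ N a by apply: lN; rewrite mem_head.
have [||||h1 [h1' [Th1 h1r H1]]] := IH (e / 2) (8 * C) => //.
- by move=> b bl; apply: lN; rewrite in_cons bl orbT.
- by rewrite divr_gt0.
- by rewrite mulr_gt0.
pose G z := g z + h1 z; pose G' z := g' z + h1' z.
have TG : tame G G' by exact: tameD.
have [M0 TM0] := TG r' r'0.
pose M := `|M0| + 1.
have M1 : 0 < M by rewrite ltr_wpDl.
have TM : tame_on (far r') G G' M.
  apply: tame_on_sub TM0 => //.
  by rewrite (le_trans (ler_norm _))// lerDl.
(* The bound 1 is required by [tame_on_lip]; the bound C / (4M) makes [G] vary by less than [C] on
   the disc. *)
pose tau1 := Num.min (Num.min tau 1) (C / (4 * M)).
have tau10 : 0 < tau1.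
  by rewrite !lt_min tau0 ltr01 divr_gt0// mulr_gt0.
have tau1M : 2 * M * tau1 < C.
  apply: (@le_lt_trans _ _ (2 * M * (C / (4 * M)))).
    by apply: ler_wpM2l; [lra|rewrite ge_min lexx orbT].
  have -> : 2 * M * (C / (4 * M)) = C / 2 by field; rewrite gt_eqF.
  by lra.
(* Two demands on the exponent: 2^m > C + M, so that the pole dominates on its disc, and a [k] large
   enough for trapping within [tau1]. *)
have [m0 Hm0] : exists m0, forall m, (m0 <= m)%N -> (1 / 2) ^+ m * (C + M) < 1.
  by apply: geometric_small => //; apply/andP; split; lra.
have [k1 Hk1] : exists k1, forall k, (k1 <= k)%N ->
    (2 / 3) ^+ k * (B0 + cmod a) < tau1.
  by apply: geometric_small => //; apply/andP; split; lra.
have p8 : cmod ((r / 8)%:C : CC R) <= r / 8.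
  by rewrite cmodR ger0_norm// divr_ge0// ltW.
have e2 : 0 < e / 2 by rewrite divr_gt0.
have [k0 Hk0] := tame_on_pole 1 m0 Na r0 e2 p8.
pose k := maxn k0 k1; pose p : CC R := (r / 8)%:C; pose m := (2 ^ k)%N.
have [Tp mm] := Hk0 k (leq_maxl _ _).
have k1k := Hk1 k (leq_maxr _ _).
exists (fun z => h1 z + 1 * pole a p m z), (fun z => h1' z + 1 * dpole a p m z).
split.
- by apply: tameD => //; exact: tame_pole.
- by rewrite (splitr e); exact: tame_onD.
move=> S cS Sr HS.
have HS' z : S z -> cmod (G z + pole a p m z) < C.
  by move=> Sz; have := HS _ Sz; rewrite mul1r addrA.
have [[z0 Sz0 Gz0]|nG] := pselect (exists2 z0, S z0 & 8 * C <= cmod (G z0)).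
  left; exists z0 => // z Sz.
  apply: (@lt_le_trans _ _ tau1); last by rewrite !ge_min lexx.
  move: z Sz; apply: (pole_traps (a := a) (p := p) cS Sz0 tau10 _ _ _ Gz0 HS' k1k).
  - by move=> /Sr/(far_N r'0).
  - move=> z /Sr/(far_N r'0) Nz.
    by rewrite (le_trans (cmodD _ _))// cmodN lerD2r NB.
  - move=> z Sz zz; apply: le_lt_trans tau1M.
    apply: le_trans (tame_on_lip TM (Sr _ Sz) (Sr _ Sz0) _) _.
      by rewrite (le_trans zz)// !ge_min lexx orbT.
    by rewrite ler_wpM2l//; lra.
have HG z : S z -> cmod (G z) < 8 * C.
  by move=> Sz; rewrite ltNge; apply/negP => HG; apply: nG; exists z.
have [|H] := H1 S cS Sr HG; first by left.
right => b; rewrite in_cons => /orP[/eqP -> z Sz|/H//].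
rewrite ltNge; apply/negP => za.
have za0 : 0 < cmod (z - a).
  by apply: lt_le_trans r'0 _; exact: far_cmod Na (Sr _ Sz).
(* On the disc |z - a| <= r/16 the ratio |p / (z - a)| is at least (r/8) / (r/16) = 2. *)
have pz : 2 ^+ m <= cmod (pole a p m z).
  rewrite /pole cmodX; apply: lerXn2r; rewrite ?nnegrE ?cmod_ge0//.
  rewrite cmodM cmodV cmodR ger0_norm; last by rewrite divr_ge0// ltW.
  by rewrite ler_pdivlMr//; lra.
have CM : C + M < 2 ^+ m.
  have p0 : 0 < 2 ^+ m :> R by rewrite exprn_gt0.
  rewrite -(mul1r (2 ^+ m)) -ltr_pdivrMr// mulrC.
  by have := Hm0 m mm; rewrite expr_div_n expr1n div1r.
have [GM _ _] := TM _ _ (Sr _ Sz) (Sr _ Sz).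
have := cmodD (G z + pole a p m z) (- G z).
by rewrite addrAC subrr add0r cmodN; have := HS' _ Sz; lra.
Qed.

(* The last pole added is centred next to [p] and only serves to cancel the
   value at [p]; these zeros make the graph non-proper. *)
Lemma barrier_stage r g g' e C : 0 < r -> tame g g' -> 0 < e -> 0 < C ->
  exists h h', [/\ tame h h', tame_on (far r) h h' e,
    (forall S z1 z2, connected S -> S `<=` far (r / 64) ->
      S z1 -> r / 32 <= bdist N z1 -> S z2 -> bdist N z2 <= r / 64 ->
      exists2 z, S z & C <= cmod (g z + h z)) &
    exists p, [/\ N p, bdist N p <= r / 64 & g p + h p = 0]].
Proof.
move=> r0 Tg e0 C0.
have [l [lN Hl]] := boundary_net r0.
have e2 : 0 < e / 2 by rewrite divr_gt0.
have r64 : 0 < r / 64 by rewrite divr_gt0.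
(* The threshold C + e leaves room for the cancelling pole, which is at most e/2 on
   [far (r / 64)]. *)
have [h1 [h1' [Th1 h1r H1]]] : exists h h',
    [/\ tame h h', tame_on (far r) h h' (e / 2) &
    forall S, connected S -> S `<=` far (r / 64) ->
      (forall z, S z -> cmod (g z + h z) < C + e) ->
      (exists2 z0, S z0 & forall z, S z -> cmod (z - z0) < r / 128) \/
      (forall a, a \in l -> forall z, S z -> r / 16 < cmod (z - a))].
  by apply: (barrier_poles _ _ lN Tg) => //; lra.
(* Since 512 = 8 * 64, the pole with numerator p - a satisfies the size condition of [tame_on_pole]
   at scale r/64. It equals 1 at [p], so the coefficient [c] is the value it adds there. *)
have [|p Np pr] := @near_boundary (r / 512); first by rewrite divr_gt0.
have [a Na pa] := bdist_lt NC pr.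
have pa0 : p - a != 0 by rewrite subr_eq0; apply/eqP => E; apply: Na; rewrite -E.
pose c := - (g p + h1 p).
have [|k0 /(_ k0 (leqnn _)) [Tp _]] :=
    @tame_on_pole a (p - a) c 0 (r / 64) (e / 2) Na r64 e2.
  by rewrite ltW// (lt_le_trans pa)//; lra.
have Tpr : tame_on (far r) (fun z => c * pole a (p - a) (2 ^ k0) z)
    (fun z => c * dpole a (p - a) (2 ^ k0) z) (e / 2).
  by apply: tame_on_sub Tp => //; apply: far_sub; lra.
exists (fun z => h1 z + c * pole a (p - a) (2 ^ k0) z),
       (fun z => h1' z + c * dpole a (p - a) (2 ^ k0) z); split.
- by apply: tameD => //; exact: tame_pole.
- by rewrite (splitr e); exact: tame_onD.
- move=> S z1 z2 cS Sr Sz1 z1r Sz2 z2r; apply: contrapT => /forall2NP HS.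
  have HC z : S z -> cmod (g z + h1 z) < C + e.
    move=> Sz; have [//|] := HS z; move/negP; rewrite -ltNge addrA => H.
    have [P1 _ _] := Tp _ _ (Sr _ Sz) (Sr _ Sz).
    have := cmodD (g z + h1 z + c * pole a (p - a) (2 ^ k0) z)
      (- (c * pole a (p - a) (2 ^ k0) z)).
    by rewrite addrK cmodN; lra.
  (* A disc of radius r/128 is too small to contain both [z1] and [z2], whose distances to the
     complement differ by at least r/64. The other case fails because the pole discs cover [z2]. *)
  have [[z0 Sz0 Hz0]|H] := H1 S cS Sr HC.
    have := bdist_lip NC z1 z2; have := cmod_tri z1 z0 z2.
    have := Hz0 _ Sz1; have := Hz0 _ Sz2; rewrite (cmod_distC z2) => A1 A2 A3 A4.
    by lra.
  have [|a' al za'] := Hl z2 (far_N r64 (Sr _ Sz2)); first by lra.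
  by have := H _ al _ Sz2; lra.
- exists p; split => //; first by lra.
  by rewrite /pole divff// expr1n mulr1 addrA subrr.
Qed.

End Stages.

(** * Limits of geometrically convergent sequences *)

Section GeometricLimits.
Variable R : realType.

Let half_gt0 n : 0 < (1 / 2) ^+ n :> R.
Proof. by rewrite exprn_gt0//; lra. Qed.

(** The intervals of radius 2 * 2^-n about [x n] meet pairwise, so the supremum of their left
    endpoints lies in all of them. *)
Lemma geometric_limit (x : nat -> R) n0 :
  (forall n, (n0 <= n)%N -> `|x n.+1 - x n| <= (1 / 2) ^+ n) ->
  exists l, forall n, (n0 <= n)%N -> `|x n - l| <= 2 * (1 / 2) ^+ n.
Proof.
move=> H.
have tail n m : (n0 <= n)%N ->
    `|x (n + m)%N - x n| <= 2 * (1 / 2) ^+ n - 2 * (1 / 2) ^+ (n + m).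
  move=> nn; elim: m => [|m IH]; first by rewrite addn0 !subrr normr0.
  have := H (n + m)%N (leq_trans nn (leq_addr _ _)).
  rewrite addnS exprS; move: IH; rewrite !ler_norml => /andP[? ?] /andP[? ?].
  by apply/andP; split; lra.
have cross n m : (n0 <= n)%N -> (n0 <= m)%N ->
    x n - 2 * (1 / 2) ^+ n <= x m + 2 * (1 / 2) ^+ m.
  move=> nn nm; have [nm'|mn] := leqP n m.
    have := tail n (m - n)%N nn; rewrite subnKC// ler_norml => /andP[].
    by have := half_gt0 m; lra.
  have := tail m (n - m)%N nm; rewrite subnKC ?(ltnW mn)// ler_norml => /andP[].
  by have := half_gt0 n; lra.
pose A := [set x n - 2 * (1 / 2) ^+ n | n in [set n | (n0 <= n)%N]].
have A0 : A !=set0 by exists (x n0 - 2 * (1 / 2) ^+ n0), n0 => /=.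
exists (sup A) => n nn; rewrite ler_distl; apply/andP; split.
  by rewrite lerBlDr; apply: ge_sup => // _ [m /= nm <-]; exact: cross.
rewrite -lerBlDr; apply: ub_le_sup; last by exists n.
by exists (x n0 + 2 * (1 / 2) ^+ n0) => _ [m /= nm <-]; exact: cross.
Qed.

Lemma geometric_climit (x : nat -> CC R) n0 :
  (forall n, (n0 <= n)%N -> cmod (x n.+1 - x n) <= (1 / 2) ^+ n) ->
  exists l, forall n, (n0 <= n)%N -> cmod (x n - l) <= 4 * (1 / 2) ^+ n.
Proof.
move=> H.
have [|a Ha] := @geometric_limit (fun n => complex.Re (x n)) n0.
  by move=> n nn; rewrite -ReB (le_trans (Re_le_cmod _))// H.
have [|b Hb] := @geometric_limit (fun n => complex.Im (x n)) n0.
  by move=> n nn; rewrite -ImB (le_trans (Im_le_cmod _))// H.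
exists (a +i* b) => n nn; rewrite (le_trans (cmod_le_ReIm _))// ReB ImB /=.
by have := Ha n nn; have := Hb n nn; lra.
Qed.

Lemma le_geometric (a b c : R) n0 :
  (forall n, (n0 <= n)%N -> a <= b + (1 / 2) ^+ n * c) -> a <= b.
Proof.
move=> H; apply/ler_addgt0Pr => e e0.
have [|n1 H1] := @geometric_small R (1 / 2) c e _ e0.
  by apply/andP; split; lra.
have := H _ (leq_maxl n0 n1); have := H1 _ (leq_maxr n0 n1); lra.
Qed.

End GeometricLimits.

(** * Iterating the stages and passing to the limit *)

Section BarrierFunction.
Variables (R : realType) (N : set (CC R)) (B0 : R).
Hypotheses (oN : open N) (NC : ~` N !=set0) (N0 : N !=set0).
Hypothesis NB : forall z, N z -> cmod z <= B0.

(** A partial sum, its derivative and the current scale. *)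
Let state := ((CC R -> CC R) * (CC R -> CC R) * R)%type.
Let inv (s : state) := tame N s.1.1 s.1.2 /\ 0 < s.2.
Let next n (s t : state) := [/\ inv t, t.2 <= s.2 / 64,
  tame_on (far N s.2) (fun z => t.1.1 z - s.1.1 z)
    (fun z => t.1.2 z - s.1.2 z) ((1 / 2) ^+ n),
  (forall S z1 z2, connected S -> S `<=` far N (s.2 / 64) ->
      S z1 -> s.2 / 32 <= bdist N z1 -> S z2 -> bdist N z2 <= s.2 / 64 ->
      exists2 z, S z & n.+1%:R <= cmod (t.1.1 z)) &
  exists p, [/\ far N t.2 p, bdist N p <= s.2 / 64 & t.1.1 p = 0]].

Let next_exists n s : inv s -> exists t, next n s t.
Proof.
case: s => [[g g'] r] [/= Tg r0].
have n0 : 0 < n.+1%:R :> R by [].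
have e0 : 0 < (1 / 2) ^+ n :> R by rewrite exprn_gt0//; lra.
have [h [h' [Th Thr Hb [p [Np pr gp]]]]] := barrier_stage NC N0 NB r0 Tg e0 n0.
(* The scale also drops to [bdist N p], so that [p] lies in the far set on which later corrections
   are controlled. *)
exists (fun z => g z + h z, fun z => g' z + h' z, Num.min (r / 64) (bdist N p)).
rewrite /next /inv /=; split.
- split; first exact: tameD.
  by rewrite lt_min divr_gt0//= bdist_gt0.
- by rewrite ge_min lexx.
- rewrite (_ : (fun z => _) = h); last first.
    by apply/funext => z; rewrite addrAC subrr add0r.
  rewrite (_ : (fun z => _) = h')//; apply/funext => z.
  by rewrite addrAC subrr add0r.
- exact: Hb.
- by exists p; split => //; rewrite /far /= ge_min lexx orbT.
Qed.

(** The limit differs from the n-th sum by at most 4 * 2^-n on its far set, so the barriers, whose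
    heights tend to infinity, and the zeros of the stages survive up to an error of 4. *)
Lemma barrier_function : exists f f', [/\ tame N f f',
  (forall q A, N q -> exists d, [/\ 0 < d, d < bdist N q &
    forall S z, connected S -> S `<=` far N d -> S q -> S z ->
      bdist N z <= d -> exists2 w, S w & A <= cmod (f w)]) &
  forall d, 0 < d -> exists p, [/\ N p, bdist N p <= d & cmod (f p) <= 4]].
Proof.
have half_gt0 n : 0 < (1 / 2) ^+ n :> R by rewrite exprn_gt0//; lra.
have half_le1 n : (1 / 2) ^+ n <= 1 :> R by rewrite exprn_ile1//; lra.
(* On states violating [inv] the chosen value is arbitrary; the sequence [st] never meets one. *)
have [F HF] : {F : nat * state -> state &
    forall ns : nat * state, inv ns.2 -> next ns.1 ns.2 (F ns)}.
  apply: (@choice _ _ (fun ns t => inv ns.2 -> next ns.1 ns.2 t)) => -[n s].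
  have [i|ni] := pselect (inv s).
    by have [t Ht] := next_exists n i; exists t.
  by exists s.
pose st := fix st n := if n is m.+1 then F (m, st m)
  else (fun=> 0, fun=> 0, 1) : state.
have st0 : inv (st 0%N).
  by split => //= r _; exists 0; exact: tame_on0.
have stS n : next n (st n) (st n.+1).
  by elim: n => [|n [i _ _ _ _]]; exact: (HF (_, _)).
have sti n : inv (st n) by case: n => [|n] //; case: (stS n).
pose f n := (st n).1.1; pose f' n := (st n).1.2; pose r n := (st n).2.
have r_gt0 n : 0 < r n by case: (sti n).
have rS n : r n.+1 <= r n / 64 by case: (stS n).
have r_small n : r n <= (1 / 2) ^+ n.
  elim: n => [|n IH]; first by rewrite expr0.
  by rewrite exprS; have := rS n; have := half_gt0 n; lra.
have r_mono m n : (n <= m)%N -> r m <= r n.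
  move=> /subnK <-; elim: (m - n)%N => // k IH; rewrite addSn.
  by have := rS (k + n)%N; have := r_gt0 (k + n)%N; lra.
have far_mono m n z : (n <= m)%N -> far N (r n) z -> far N (r m) z.
  by move=> nm; apply: far_sub; exact: r_mono.
have tameS n : tame_on (far N (r n)) (fun z => f n.+1 z - f n z)
   (fun z => f' n.+1 z - f' n z) ((1 / 2) ^+ n) by case: (stS n).
have r_lt e : 0 < e -> exists n, forall m, (n <= m)%N -> r m < e.
  move=> e0; have [|n Hn] := @geometric_small R (1 / 2) 1 e _ e0.
    by apply/andP; split; lra.
  exists n => m nm; apply: le_lt_trans (r_small m) _.
  by have := Hn m nm; rewrite mulr1.
have lim (x : nat -> CC R -> CC R) :
    (forall n z, far N (r n) z -> cmod (x n.+1 z - x n z) <= (1 / 2) ^+ n) ->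
    {l : CC R -> CC R & forall z n, far N (r n) z ->
      cmod (x n z - l z) <= 4 * (1 / 2) ^+ n}.
  move=> Hx; apply: (@choice _ _ (fun z l => forall n, far N (r n) z ->
    cmod (x n z - l) <= 4 * (1 / 2) ^+ n)) => z.
  (* From the least [n0] with [z] in its far set on, all increments at [z] are controlled. A point
     in no far set gets the default 0. *)
  have [ex|nex] := pselect (exists n, `[< far N (r n) z >]); last first.
    by exists 0 => n nz; case: nex; exists n; apply/asboolP.
  case: (ex_minnP ex) => n0 /asboolP n0z n0min.
  have [l Hl] : exists l, forall n, (n0 <= n)%N ->
      cmod (x n z - l) <= 4 * (1 / 2) ^+ n.
    apply: (@geometric_climit _ (fun n => x n z)) => n nn.
    by apply: Hx; exact: far_mono n0z.
  by exists l => n nz; apply/Hl/n0min/asboolP.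
have [g Hg] : {l : CC R -> CC R & forall z n, far N (r n) z ->
    cmod (f n z - l z) <= 4 * (1 / 2) ^+ n}.
  by apply: lim => n z nz; case: (tameS n _ _ nz nz).
have [g' Hg'] : {l : CC R -> CC R & forall z n, far N (r n) z ->
    cmod (f' n z - l z) <= 4 * (1 / 2) ^+ n}.
  by apply: lim => n z nz; case: (tameS n _ _ nz nz).
exists g, g'; split.
- move=> e e0; have [n /(_ n (leqnn _)) ne] := r_lt e e0.
  have [Tn _] := sti n; have [M TM] := Tn (r n) (r_gt0 n).
  (* Stage [j] adds 2^-j to the constant; the telescoping form bounds all later sums by M + 2. *)
  have TMk k : tame_on (far N (r n)) (f (n + k)%N) (f' (n + k)%N)
      (M + 2 * (1 / 2) ^+ n - 2 * (1 / 2) ^+ (n + k)).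
    elim: k => [|k IH]; first by rewrite addn0 addrK.
    have T := tame_onD IH (tame_on_sub
      (fun z => @far_mono (n + k)%N n z (leq_addr _ _)) (lexx _) (tameS _)).
    have E x y : (fun z : CC R => x z + (y z - x z)) = y :> (CC R -> CC R).
      by apply/funext => z; rewrite addrC subrK.
    move: T; rewrite addnS !E => T; apply: (tame_on_sub (@subset_refl _ _) _ T).
    by rewrite [(1 / 2) ^+ _.+1]exprS; lra.
  have Tk k : (n <= k)%N -> tame_on (far N (r n)) (f k) (f' k) (M + 2).
    move=> nk; have := TMk (k - n)%N; rewrite subnKC// => T.
    apply: (tame_on_sub (@subset_refl _ _) _ T).
    by have := half_gt0 k; have := half_le1 n; lra.
  exists (M + 2) => z w ze we.
  have zn : far N (r n) z by apply: far_sub ze; exact: ltW.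
  have wn : far N (r n) w by apply: far_sub we; exact: ltW.
  split.
  + apply: (@le_geometric _ _ _ 4 n) => k nk.
    have [H _ _] := Tk k nk _ _ zn wn.
    have := Hg z k (far_mono _ _ _ nk zn); have := cmod_subD (g z) (f k z).
    by rewrite (cmod_distC (g z)); lra.
  + apply: (@le_geometric _ _ _ 4 n) => k nk.
    have [_ H _] := Tk k nk _ _ zn wn.
    have := Hg' z k (far_mono _ _ _ nk zn); have := cmod_subD (g' z) (f' k z).
    by rewrite (cmod_distC (g' z)); lra.
  (* Replacing the limits by the k-th stage costs 4 * 2^-k for each of the two values, and |z - w|
     times as much for the derivative. *)
  + apply: (@le_geometric _ _ _ (8 + 4 * cmod (z - w)) n) => k nk.
    have [_ _ H] := Tk k nk _ _ zn wn.
    have := Hg z k (far_mono _ _ _ nk zn); have := Hg w k (far_mono _ _ _ nk wn).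
    have /(ler_wpM2r (cmod_ge0 (z - w))) := Hg' w k (far_mono _ _ _ nk wn).
    rewrite -cmodM.
    have -> : g z - g w - g' w * (z - w) = (f k z - f k w - f' k w * (z - w)) -
      ((f k z - g z) - (f k w - g w) - (f' k w - g' w) * (z - w)) by ring.
    set X := f k z - f k w - _; set Y := f k z - g z; set Z := f k w - g w.
    set V := (f' k w - g' w) * (z - w).
    have := cmodD X (- (Y - Z - V)); have := cmodD (Y - Z) (- V).
    by have := cmodD Y (- Z); rewrite !cmodN; move: H; rewrite -/X; lra.
- move=> q A Nq.
  have q0 := bdist_gt0 NC oN Nq.
  have [n1 Hn1] := r_lt _ q0.
  (* The stage must start below the distance of [q] to the complement, and its height n + 1 must
     exceed [A] by the 4 lost in the limit. *)
  pose n := maxn n1 (Num.truncn (A + 4)).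
  have rq : r n < bdist N q by apply: Hn1; exact: leq_maxl.
  have An : A + 4 <= n.+1%:R.
    have [A0|A0] := leP 0 (A + 4); last by rewrite (le_trans (ltW A0)).
    have /andP[_ /ltW/le_trans] := truncn_itv A0; apply.
    by rewrite ler_nat ltnS leq_maxr.
  have rn := r_gt0 n.
  exists (r n / 64); split; [by rewrite divr_gt0|lra|].
  move=> S z cS Sr Sq Sz zr; case: (stS n) => _ rr _ Hb _.
  have [|w Sw Hw] := Hb S q z cS Sr Sq _ Sz zr; first by rewrite -/(r n); lra.
  exists w => //; have wn : far N (r n.+1) w by exact: far_sub (Sr _ Sw).
  have := Hg w n.+1 wn; have := cmod_subD (f n.+1 w) (g w).
  by move: Hw; rewrite -/(f n.+1); have := half_le1 n.+1; lra.
- move=> d d0; have [n /(_ n (leqnn _)) nd] := r_lt _ d0.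
  case: (stS n) => _ _ _ _ [p [pn pr p0]]; exists p; split.
  + exact: (far_N NC (r_gt0 n.+1) pn).
  + by have := r_gt0 n; move: pr; rewrite -/(r n); lra.
  + have := Hg p n.+1 pn; rewrite /f p0 sub0r cmodN.
    by have := half_le1 n.+1; lra.
Qed.
End BarrierFunction.

(** * Cauchy sequences and compact squares in the plane *)

Section ComplexCompleteness.
Variable R : realType.

Lemma real_cauchy (x : nat -> R) :
  (forall e, 0 < e -> exists M, forall m n, (M <= m)%N -> (M <= n)%N ->
    `|x m - x n| < e) ->
  exists l, forall e, 0 < e -> exists M, forall n, (M <= n)%N -> `|x n - l| < e.
Proof.
move=> H; have : cvg (x @ \oo).
  apply/cauchy_cvgP/cauchy_exP => e e0; have [M HM] := H e e0.
  by exists (x M); exists M => // n /= Mn; rewrite -ball_normE /=; exact: HM.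
move=> /cvgrPdist_lt cx; exists (lim (x @ \oo)) => e e0.
have [M _ HM] := cx e e0; exists M => n Mn.
by rewrite distrC; exact: HM.
Qed.

Lemma complex_cauchy (x : nat -> CC R) :
  (forall e, 0 < e -> exists M, forall m n, (M <= m)%N -> (M <= n)%N ->
    cmod (x m - x n) < e) ->
  exists l, forall e, 0 < e -> exists M, forall n, (M <= n)%N ->
    cmod (x n - l) < e.
Proof.
move=> H.
have [|a Ha] := @real_cauchy (fun n => complex.Re (x n)).
  move=> e /H[M HM]; exists M => m n Mm Mn.
  by rewrite -ReB (le_lt_trans (Re_le_cmod _))// HM.
have [|b Hb] := @real_cauchy (fun n => complex.Im (x n)).
  move=> e /H[M HM]; exists M => m n Mm Mn.
  by rewrite -ImB (le_lt_trans (Im_le_cmod _))// HM.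
exists (a +i* b) => e e0; have e2 : 0 < e / 2 by rewrite divr_gt0.
have [M1 H1] := Ha _ e2; have [M2 H2] := Hb _ e2.
exists (maxn M1 M2) => n; rewrite geq_max => /andP[/H1 A1 /H2 A2].
by rewrite (le_lt_trans (cmod_le_ReIm _))// ReB ImB /=; lra.
Qed.

Lemma csquare_compact (B : R) :
  compact [set z : CC R | `|complex.Re z| <= B /\ `|complex.Im z| <= B].
Proof.
have -> : [set z : CC R | `|complex.Re z| <= B /\ `|complex.Im z| <= B] =
  (fun xy : R * R => xy.1 +i* xy.2 : CC R) @` (`[- B, B] `*` `[- B, B]).
  apply/seteqP; split => [[x y] /= [Hx Hy]|_ [[x y] [/= Hx Hy] <-]] /=.
    by exists (x, y); rewrite // /=; split; rewrite /= in_itv /= -ler_norml.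
  by move: Hx Hy; rewrite !in_itv /= -!ler_norml.
apply: continuous_compact; last by apply: compact_setX; exact: segment_compact.
apply: continuous_subspaceT => -[x y] P /near_cmodP[e e0 HP].
have e2 : 0 < e / 2 by rewrite divr_gt0.
apply/nbhs_ballP; exists (e / 2) => //= -[x' y'] [/=].
rewrite -!ball_normE /= => Hx Hy; apply: HP.
rewrite (le_lt_trans (cmod_le_ReIm _))//=.
by rewrite distrC [`|y' - y|]distrC; lra.
Qed.

End ComplexCompleteness.

(** * Graphs of tame functions, and their variation along paths *)

Section TameFunctions.
Variables (R : realType) (N : set (CC R)).
Hypotheses (oN : open N) (NC : ~` N !=set0).
Variables (f f' : CC R -> CC R).
Hypothesis Tf : tame N f f'.
Implicit Types (z w c : CC R).

(** A disc of radius at most half the distance to the complement stays in one far set, whose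
    constant serves all the bounds. *)
Lemma tame_local z : N z -> exists M e, [/\ 0 < M, 0 < e &
  forall w, cmod (w - z) < e -> [/\ N w,
    cmod (f w - f z - f' z * (w - z)) <= M * cmod (w - z) ^+ 2,
    cmod (f w - f z) <= M * cmod (w - z) &
    cmod (f' w - f' z) <= M * cmod (w - z)]].
Proof.
move=> Nz; have z0 := bdist_gt0 NC oN Nz.
pose r := bdist N z / 2; have r0 : 0 < r by rewrite divr_gt0.
have [M0 TM] := Tf r0.
have zr : far N r z by rewrite /far /= /r; lra.
have [/(le_trans (cmod_ge0 _)) M00 _ _] := TM z z zr zr.
exists (2 * M0 + 1), (Num.min r 1); split; [lra|by rewrite lt_min r0 ltr01|].
move=> w; rewrite lt_min => /andP[wr w1].
have wfar : far N r w.
  by have := bdist_lip NC z w; rewrite cmod_distC /far /= /r; move: wr; rewrite /r; lra.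
have X0 := cmod_ge0 (w - z).
split.
- exact: far_N wfar.
- have [_ _ H] := TM _ _ wfar zr.
  by rewrite (le_trans H)// ler_wpM2r ?sqr_ge0//; lra.
- rewrite (le_trans (tame_on_lip TM wfar zr (ltW w1)))// ler_wpM2r//; lra.
- rewrite (le_trans (tame_on_deriv_lip TM wfar zr))// ler_wpM2r//; lra.
Qed.

Lemma lip_continuous_at (g : CC R -> CC R) z M e : 0 < M -> 0 < e ->
  (forall w, cmod (w - z) < e -> cmod (g w - g z) <= M * cmod (w - z)) ->
  {for z, continuous g}.
Proof.
move=> M0 e0 H P /near_cmodP[d d0 HP]; apply/near_cmodP.
exists (Num.min e (d / M)); first by rewrite lt_min e0 divr_gt0.
move=> w; rewrite lt_min => /andP[we wd]; apply: HP.
by rewrite (le_lt_trans (H _ we))// mulrC -ltr_pdivlMr.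
Qed.

Lemma tame_continuous z : N z -> {for z, continuous f}.
Proof.
move=> /tame_local[M [e [M0 e0 H]]].
by apply: (lip_continuous_at M0 e0) => w /H[].
Qed.

Lemma tame_deriv_continuous z : N z -> {for z, continuous f'}.
Proof.
move=> /tame_local[M [e [M0 e0 H]]].
by apply: (lip_continuous_at M0 e0) => w /H[].
Qed.

Definition graph z : CC R * CC R := (z, f z).

Lemma graph_cvg z : N z ->
  (fun h : CC R => h^-1 *: (graph (h *: (1 : CC R) + z) - graph z)) @ 0^' -->
  ((1, f' z) : CC R * CC R).
Proof.
move=> /tame_local[M [e [M0 e0 H]]].
rewrite (_ : (fun h => _) = fun h : CC R => (h^-1 *: (h *: (1 : CC R)),
    h^-1 *: (f (h *: (1 : CC R) + z) - f z))); last first.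
  apply/funext => h; rewrite [LHS]surjective_pairing /=.
  by congr (_ *: _, _); exact: addrK.
have H1 : (fun h : CC R => h^-1 *: (h *: (1 : CC R)) : CC R) @ 0^' --> (1 : CC R).
  move=> P /near_cmodP[d d0 HP].
  apply: filterS (nbhs_dnbhs_neq (0 : CC R)) => h h0; apply: HP.
  suff -> : h^-1 *: (h *: (1 : CC R)) = 1 by rewrite subrr cmod0.
  by rewrite scalerA mulVf// scale1r.
have H2 : (fun h : CC R => h^-1 *: (f (h *: (1 : CC R) + z) - f z) : CC R) @ 0^' -->
    f' z.
  move=> P /near_cmodP[d d0 HP].
  apply/near_cmodP; exists (Num.min e (d / M)).
    by rewrite lt_min e0 divr_gt0.
  move=> h; rewrite subr0 lt_min => /andP[he hd] h0; apply: HP.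
  have hE : h *: (1 : CC R) = h by rewrite /GRing.scale /= mulr1.
  rewrite hE; have [|_ H2 _ _] := H (h + z); first by rewrite addrK.
  move: H2; rewrite addrK => H2.
  have -> : h^-1 *: (f (h + z) - f z) - f' z =
      h^-1 * (f (h + z) - f z - f' z * h) :> CC R.
    by rewrite /GRing.scale /=; field.
  have hh : 0 < cmod h by rewrite cmod_gt0.
  rewrite cmodM cmodV mulrC ltr_pdivrMr// (le_lt_trans H2)//.
  by rewrite expr2 mulrA ltr_pM2r// mulrC -ltr_pdivlMr.
exact: (cvg_pair H1 H2).
Qed.

Lemma graph_derivable z : N z -> derivable graph z (1 : CC R).
Proof. by move=> /graph_cvg /cvgP. Qed.

Lemma graph_derive1 z : N z -> derive1 graph z = (1, f' z).
Proof. by move=> Nz; rewrite derive1E; apply: cvg_lim => //; exact: graph_cvg. Qed.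

(** The first coordinate is the identity: the derivative has first component 1, and the first
    projection is a continuous inverse. *)
Lemma graph_embedding : holomorphic_embedding N graph.
Proof.
split.
- exact: graph_derivable.
- move=> z Nz; rewrite graph_derive1//; apply/eqP => -[/eqP].
  by rewrite oner_eq0.
- split.
    apply: continuous_in_subspaceT => z /set_mem Nz.
    exact: (@cvg_pair _ _ _ (nbhs z) (nbhs z) (nbhs (f z)) _ _ _ id f cvg_id
      (tame_continuous Nz)).
  exists fst; split => //; apply: continuous_subspaceT => p; exact: cvg_fst.
Qed.

Lemma graph_induced_norm z v : N z ->
  induced_norm graph z v = Num.sqrt (cmod v ^+ 2 + cmod (v * f' z) ^+ 2).
Proof.
move=> Nz; rewrite /induced_norm graph_derive1// /euclidean_norm.
by congr (Num.sqrt (cmod _ ^+ 2 + _)); exact: mulr1.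
Qed.

(** A chain rule mixing real and complex differentiation. The factor [c] will rotate an increment of
    [f] onto the positive real axis. *)
Lemma path_is_derive (gamma : R -> CC R) t c : N (gamma t) ->
  derivable (@complex.Re R \o gamma) t 1 ->
  derivable (@complex.Im R \o gamma) t 1 ->
  is_derive t (1 : R) (fun s => complex.Re (c * f (gamma s)))
    (complex.Re (c * (f' (gamma t) * velocity gamma t))).
Proof.
move=> /tame_local[M [e [M0 e0 H]]] dX dY.
set X := @complex.Re R \o gamma in dX; set Y := @complex.Im R \o gamma in dY.
pose qx (h : R) : R := h^-1 *: (X (h *: (1 : R) + t) - X t).
pose qy (h : R) : R := h^-1 *: (Y (h *: (1 : R) + t) - Y t).
have Hx : qx h @[h --> (0 : R)^'] --> derive1 X t.
  by rewrite derive1E; exact: dX.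
have Hy : qy h @[h --> (0 : R)^'] --> derive1 Y t.
  by rewrite derive1E; exact: dY.
pose p := c * f' (gamma t).
pose q (h : R) : R := h^-1 *: (complex.Re (c * f (gamma (h *: (1 : R) + t))) -
  complex.Re (c * f (gamma t))).
pose lin (h : R) : R := complex.Re p * qx h - complex.Im p * qy h.
have Hlin : lin h @[h --> (0 : R)^'] -->
    complex.Re (c * (f' (gamma t) * velocity gamma t)).
  rewrite mulrA -/p /velocity -/X -/Y.
  have -> : complex.Re (p * (derive1 X t +i* derive1 Y t)) =
    complex.Re p * derive1 X t - complex.Im p * derive1 Y t by case: p {lin}.
  by apply: cvgB; apply: cvgM => //; exact: cvg_cst.
(* [S h] bounds the increment of the path, and [b h] below is |c| M (S h)^2 / |h|, the contribution
   of the quadratic remainder; both tend to zero. *)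
pose S (h : R) : R := `|h| * (`|qx h| + `|qy h|).
have H0 : (`|h| : R) @[h --> (0 : R)^'] --> (0 : R).
  have id0 : h @[h --> (0 : R)^'] --> (0 : R).
    by move=> P HP; apply: nbhs_dnbhs; exact: HP.
  by have := cvg_norm id0; rewrite normr0; exact.
have Hxy : (`|qx h| + `|qy h| : R) @[h --> (0 : R)^'] -->
    (`|derive1 X t| + `|derive1 Y t| : R).
  exact: cvgD (cvg_norm Hx) (cvg_norm Hy).
have HS : S h @[h --> (0 : R)^'] --> (0 : R).
  by have := cvgM H0 Hxy; rewrite mul0r; exact.
pose b (h : R) : R := cmod c * M * (S h * (`|qx h| + `|qy h|)).
have Hb : b h @[h --> (0 : R)^'] --> (0 : R).
  have := cvgM (@cvg_cst _ (cmod c * M) _ _ _) (cvgM HS Hxy).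
  by rewrite mul0r mulr0; exact.
have Hr : (q h - lin h) @[h --> (0 : R)^'] --> (0 : R).
  have HbN : - b h @[h --> (0 : R)^'] --> (0 : R).
    by have := cvgN Hb; rewrite oppr0; exact.
  apply: squeeze_cvgr HbN Hb.
  have N1 : \forall h \near (0 : R)^', S h < e by exact: (cvgr_lt _ HS).
  have N2 : \forall h \near (0 : R)^', h != 0 by exact: nbhs_dnbhs_neq.
  apply: filterS2 N1 N2 => h Se h0.
  rewrite -ler_norml.
  pose D := gamma (h *: (1 : R) + t) - gamma t.
  have XE : complex.Re D = h * qx h by rewrite ReB /qx /GRing.scale /=; field.
  have YE : complex.Im D = h * qy h by rewrite ImB /qy /GRing.scale /=; field.
  have DS : cmod D <= S h.
    rewrite (le_trans (cmod_le_ReIm _))// XE YE.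
    by rewrite (normrM h (qx h)) (normrM h (qy h)) -mulrDr.
  have [_ HD _ _] := H _ (le_lt_trans DS Se).
  rewrite -/D in HD.
  have -> : q h - lin h = h^-1 * complex.Re (c * (f (gamma (h *: (1 : R) + t)) -
      f (gamma t) - f' (gamma t) * D)).
    have -> : c * (f (gamma (h *: (1 : R) + t)) - f (gamma t) - f' (gamma t) * D) =
      c * f (gamma (h *: (1 : R) + t)) - c * f (gamma t) - p * D.
      by rewrite /p; ring.
    rewrite !ReB.
    have -> : complex.Re (p * D) = complex.Re p * complex.Re D -
      complex.Im p * complex.Im D by case: (p) (D) => [? ?] [? ?].
    by rewrite XE YE /q /lin /GRing.scale /=; field.
  have hh : 0 < `|h| by rewrite normr_gt0.
  rewrite normrM normfV mulrC ler_pdivrMr// (le_trans (Re_le_cmod _))// cmodM.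
  apply: (@le_trans _ _ (cmod c * (M * S h ^+ 2))).
    rewrite ler_wpM2l ?cmod_ge0// (le_trans HD)// ler_wpM2l ?(ltW M0)//.
    by rewrite lerXn2r ?nnegrE ?cmod_ge0// (le_trans (cmod_ge0 _) DS).
  by rewrite /b [S h ^+ 2]expr2 {2}/S le_eqVlt; apply/orP; left; apply/eqP; ring.
have Hq : q h @[h --> (0 : R)^'] -->
    complex.Re (c * (f' (gamma t) * velocity gamma t)).
  rewrite (_ : q = fun h => lin h + (q h - lin h)); last first.
    by apply/funext => h; rewrite addrC subrK.
  by have := cvgD Hlin Hr; rewrite addr0; exact.
by apply: DeriveDef; [exact: cvgP Hq|exact: cvg_lim Hq].
Qed.

Lemma comp_within_continuous (A : set R) (gamma : R -> CC R) (g : CC R -> CC R) :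
  (forall z, N z -> {for z, continuous g}) ->
  {within A, continuous gamma} -> (forall t, A t -> N (gamma t)) ->
  {within A, continuous (g \o gamma)}.
Proof.
move=> Hg /subspace_continuousP Hgamma HN; apply/subspace_continuousP => t At.
exact: (continuous_cvg _ (Hg _ (HN _ At)) (Hgamma _ At)).
Qed.

(** The fundamental theorem of calculus for Re (c f(gamma)), with its derivative bounded by [k].
    Integrals are compared on the open interval, as [velocity] is meaningless at the break
    points. *)
Lemma piece_length_lower (gamma : R -> CC R) (k : R -> R) a b c :
  a < b -> {within `[a, b], continuous gamma} -> C1_on gamma a b ->
  (forall t, t \in `[a, b] -> N (gamma t)) -> cmod c <= 1 ->
  (forall t, 0 <= k t) -> measurable_fun `]a, b[ k ->
  (forall t, t \in `]a, b[ -> cmod (f' (gamma t) * velocity gamma t) <= k t) ->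
  ((complex.Re (c * f (gamma b)) - complex.Re (c * f (gamma a)))%:E <=
    \int[lebesgue_measure]_(t in `[a, b]) (k t)%:E)%E.
Proof.
move=> ab cg [dg [delta [cd dE]]] gN c1 k0 mk fk.
have gN' t : `[a, b]%classic t -> N (gamma t) by exact: gN.
pose psi t := complex.Re (c * f (gamma t)).
(* Built from the extension [delta] instead of [velocity], the derivative is continuous on the
   closed interval. *)
pose g t := complex.Re (c * (f' (gamma t) * delta t)).
have cpsi : {within `[a, b], continuous psi}.
  apply/subspace_continuousP => t /= tab.
  have /subspace_continuousP/(_ t tab) H :=
    comp_within_continuous tame_continuous cg gN'.
  have {}H : (fun s => c * f (gamma s) : CC R) @ within `[a, b] (nbhs t) -->
      (c * f (gamma t) : CC R).
    by apply: cvgM H; exact: cvg_cst.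
  exact: (continuous_cvg _ (@Re_continuous R _) H).
have cgg : {within `[a, b], continuous g}.
  apply/subspace_continuousP => t /= tab.
  have /subspace_continuousP/(_ t tab) H :=
    comp_within_continuous tame_deriv_continuous cg gN'.
  move/subspace_continuousP/(_ t tab): cd => H'.
  have {}H : (fun s => c * (f' (gamma s) * delta s) : CC R) @
      within `[a, b] (nbhs t) --> (c * (f' (gamma t) * delta t) : CC R).
    by apply: cvgM (cvgM H H'); exact: cvg_cst.
  exact: (continuous_cvg _ (@Re_continuous R _) H).
have sub t : t \in `]a, b[ -> t \in `[a, b].
  by rewrite !in_itv /= => /andP[/ltW -> /ltW ->].
have dpsi t : t \in `]a, b[ -> is_derive t (1 : R) psi (g t).
  move=> tab; rewrite /g dE//; have [d1 d2] := dg _ tab.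
  by apply: path_is_derive => //; exact/gN/sub.
have FTC : (\int[lebesgue_measure]_(t in `[a, b]) (g t)%:E =
    (psi b)%:E - (psi a)%:E)%E.
  apply: continuous_FTC2 => //.
    have [_ H1 H2] := (continuous_within_itvP psi ab).1 cpsi.
    by split => // t tab; have [] := dpsi t tab.
  by move=> t tab; rewrite derive1E; have [_ ->] := dpsi t tab.
rewrite EFinB -FTC.
have mg : measurable_fun `]a, b[ g.
  apply: open_continuous_measurable_fun; first exact: interval_open.
  move=> t /set_mem tab; exact: (within_continuous_continuous ab cgg).
rewrite [leLHS]integral_itv_bndoo; last exact/measurable_EFinP.
rewrite [leRHS]integral_itv_bndoo; last exact/measurable_EFinP.
apply: (le_trans (lee_abs _)).
apply: (le_trans (le_abse_integral _ _ _)) => //; first exact/measurable_EFinP.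
apply: ge0_le_integral => //.
- by apply: measurableT_comp => //; exact/measurable_EFinP.
- exact/measurable_EFinP.
- move=> t /= tab; rewrite lee_fin /g dE// (le_trans (Re_le_cmod _))// cmodM.
  by rewrite (le_trans _ (fk _ tab))// ler_piMl ?cmod_ge0.
Qed.

End TameFunctions.

(** * Lower bounds for induced lengths *)

Section PathLengths.
Variables (R : realType) (N : set (CC R)).
Hypotheses (oN : open N) (NC : ~` N !=set0).
Variables (f f' : CC R -> CC R).
Hypothesis Tf : tame N f f'.
Implicit Types (gamma : R -> CC R).

Let speed gamma t : R := induced_norm (graph f) (gamma t) (velocity gamma t).

Let speed_ge0 gamma t : 0 <= speed gamma t.
Proof. exact: sqrtr_ge0. Qed.

Lemma induced_norm_measurable gamma a b : a < b ->
  {within `[a, b], continuous gamma} -> C1_on gamma a b ->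
  (forall t, t \in `[a, b] -> N (gamma t)) ->
  measurable_fun `]a, b[ (speed gamma).
Proof.
move=> ab cg [_ [delta [cd dE]]] gN.
pose k t : R := Num.sqrt (cmod (delta t) ^+ 2 + cmod (delta t * f' (gamma t)) ^+ 2).
have kE : {in `]a, b[%classic, k =1 speed gamma}.
  move=> t /set_mem tab; rewrite /k /speed (graph_induced_norm oN NC Tf) ?dE//.
  by apply: gN; apply: subset_itv_oo_cc tab.
apply: (eq_measurable_fun k) => //.
apply: open_continuous_measurable_fun; first exact: interval_open.
move=> t /set_mem tab.
have Nt : N (gamma t) by apply: gN; apply: subset_itv_oo_cc tab.
have Hg : gamma s @[s --> t] --> gamma t.
  exact: (within_continuous_continuous ab cg).
have Hd : delta s @[s --> t] --> delta t.
  exact: (within_continuous_continuous ab cd).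
have Hf : f' (gamma s) @[s --> t] --> f' (gamma t).
  exact: (continuous_cvg _ (tame_deriv_continuous oN NC Tf Nt) Hg).
have cc : continuous (@cmod R : CC R -> R).
  by apply: short_continuous; exact: cmod_subD.
have H1 : cmod (delta s) @[s --> t] --> cmod (delta t).
  exact: (continuous_cvg _ (cc _) Hd).
have H2 : cmod (delta s * f' (gamma s)) @[s --> t] -->
    cmod (delta t * f' (gamma t)).
  have H : (delta s * f' (gamma s) : CC R) @[s --> t] -->
    (delta t * f' (gamma t) : CC R) by apply: cvgM Hd Hf.
  exact: (continuous_cvg _ (cc _) H).
have H : (cmod (delta s) ^+ 2 + cmod (delta s * f' (gamma s)) ^+ 2) @[s --> t] -->
    (cmod (delta t) ^+ 2 + cmod (delta t * f' (gamma t)) ^+ 2).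
  by apply: cvgD; exact: (continuous_cvg _ (@exprn_continuous R 2 _)).
exact: (continuous_cvg _ (@sqrt_continuous R _) H).
Qed.

Variables (phi phi' : CC R -> CC R).
Hypothesis Tphi : tame N phi phi'.
Hypothesis phi_le : forall z v, N z ->
  cmod (phi' z * v) <= induced_norm (graph f) z v.

(** Induction on the break points: if [t] lies in the first piece, that piece is cut at [t];
    otherwise its bound is added to that of the rest. Measurability is carried along for the
    additivity of the integral. *)
Let chain_length_lower gamma (c : CC R) s x : cmod c <= 1 -> path <%R x s ->
  (forall i, (i < size s)%N -> C1_on gamma (nth 0 (x :: s) i) (nth 0 s i)) ->
  {within `[x, last x s], continuous gamma} ->
  (forall t, t \in `[x, last x s] -> N (gamma t)) ->
  measurable_fun `[x, last x s] (speed gamma) /\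
  forall t, t \in `[x, last x s] ->
  ((complex.Re (c * phi (gamma t)) - complex.Re (c * phi (gamma x)))%:E <=
   \int[lebesgue_measure]_(r in `[x, last x s]) (speed gamma r)%:E)%E.
Proof.
move=> c1; elim: s x => [|y s IH] x /=.
  move=> _ _ _ _; rewrite set_itv1; split; first exact: measurable_fun_set1.
  move=> t; rewrite in_itv /= -eq_le => /eqP ->; rewrite subrr.
  by apply: integral_ge0 => r _; rewrite lee_fin.
move=> /andP[xy ys] HC cg gN.
have le_last (u : R) v : path <%R u v -> u <= last u v.
  elim: v u => //= v l IHl u /andP[uv /IHl]; exact/le_trans/ltW.
have yL := le_last y s ys.
have xL : x <= last y s by rewrite (le_trans (ltW xy)).
have s1 : `[x, y] `<=` `[x, last y s].
  by move=> t /=; rewrite !in_itv /= => /andP[-> /le_trans ->].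
have s2 : `[y, last y s] `<=` `[x, last y s].
  by move=> t /=; rewrite !in_itv /= => /andP[/(le_trans (ltW xy)) -> ->].
have cg1 := continuous_subspaceW s1 cg.
have C1 : C1_on gamma x y := HC 0%N isT.
have [//|i|||mk2 H2] := IH y; first exact: (HC i.+1).
  exact: continuous_subspaceW s2 cg.
  by move=> t ty; apply: gN; exact: s2.
have mk1 : measurable_fun `]x, y[ (speed gamma).
  by apply: induced_norm_measurable => // t ty; apply: gN; exact: s1.
have mk1' : measurable_fun `[x, y] (speed gamma) by exact: measurable_fun_itv_cc mk1.
have mk2' : measurable_fun `]y, last y s] (speed gamma).
  exact: measurable_fun_itv_oc mk2.
have split_itv : `[x, last y s]%classic = `[x, y] `|` `]y, last y s].
  by apply: itv_bndbnd_setU; rewrite bnd_simp// ltW.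
have mk : measurable_fun `[x, last y s] (speed gamma).
  by rewrite split_itv; apply/measurable_funU.
split => // t txL; have [ty|yt] := leP t y.
  have [<-|xt] := eqVneq x t.
    by rewrite subrr; apply: integral_ge0 => r _; rewrite lee_fin.
  have {}xt : x < t.
    by rewrite lt_neqAle xt; move: txL; rewrite in_itv /= => /andP[].
  have s3 : `[x, t] `<=` `[x, y].
    by move=> r /=; rewrite !in_itv /= => /andP[-> /le_trans ->].
  have s4 : `]x, t[ `<=` `]x, y[.
    by move=> r /=; rewrite !in_itv /= => /andP[-> /lt_le_trans ->].
  apply: (@le_trans _ _ (\int[lebesgue_measure]_(r in `[x, t]) (speed gamma r)%:E)%E).
    apply: (piece_length_lower oN NC Tphi) => //.
    - exact: continuous_subspaceW s3 cg1.
    - case: C1 => dg [delta [cd dE]]; split; first by move=> r /s4/dg.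
      exists delta; split; first exact: continuous_subspaceW s3 cd.
      by move=> r /s4/dE.
    - by move=> r /s3/s1/gN.
    - exact: measurable_funS s4 mk1.
    - by move=> r /s4/subset_itv_oo_cc/s1/gN Nr; exact: phi_le.
  apply: ge0_subset_integral => //; first exact/measurable_EFinP.
    by move=> r _; rewrite lee_fin.
  exact: subset_trans s3 s1.
have -> : complex.Re (c * phi (gamma t)) - complex.Re (c * phi (gamma x)) =
  (complex.Re (c * phi (gamma y)) - complex.Re (c * phi (gamma x))) +
  (complex.Re (c * phi (gamma t)) - complex.Re (c * phi (gamma y))) by ring.
rewrite split_itv ge0_integral_setU//; first last.
- apply/disj_setPS => r [] /=; rewrite !in_itv /= => /andP[_ ry] /andP[yr _].
  by move: yr; rewrite ltNge ry.
- by move=> r _; rewrite lee_fin.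
- by apply/measurable_EFinP; rewrite -split_itv.
rewrite EFinD; apply: leeD.
  apply: (piece_length_lower oN NC Tphi) => //.
  - by move=> r /s1/gN.
  - by move=> r /subset_itv_oo_cc/s1/gN Nr; exact: phi_le.
rewrite integral_itv_obnd_cbnd; last exact/measurable_EFinP.
by apply: H2; move: txL; rewrite !in_itv /= => /andP[_ ->]; rewrite ltW.
Qed.

(** The factor c = |w| / w turns Re (c w) into |w|. The function [phi] will be either coordinate of
    the graph, the identity or [f]. *)
Lemma induced_length_ge gamma p q t : path_in N p q gamma -> t \in `[0, 1] ->
  ((cmod (phi (gamma t) - phi p))%:E <= induced_length (graph f) gamma)%E.
Proof.
move=> [[cg [s [s0 s1 sC]]] gN g0 g1] t01.
set w := phi (gamma t) - phi p.
have [w0|w0] := eqVneq w 0.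
  rewrite w0 cmod0; apply: integral_ge0 => r _.
  by rewrite lee_fin; exact: speed_ge0.
pose c : CC R := (cmod w)%:C / w.
have c1 : cmod c <= 1.
  by rewrite cmodM cmodV cmodR ger0_norm ?cmod_ge0// divff// cmod_eq0.
have cg' : {within `[0, last 0 s], continuous gamma} by rewrite s1.
have gN' r : r \in `[0, last 0 s] -> N (gamma r) by rewrite s1; exact: gN.
have [_ /(_ t)] := chain_length_lower c1 s0 sC cg' gN'.
by rewrite s1 g0 -ReB -mulrBr -/w /c divfK//; exact.
Qed.

End PathLengths.

(** * Completeness and non-properness of the graph *)

Section Completeness.
Variables (R : realType) (N : set (CC R)) (B0 : R).
Hypotheses (oN : open N) (NC : ~` N !=set0).
Hypothesis NB : forall z, N z -> cmod z <= B0.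
Variables (f f' : CC R -> CC R).
Hypothesis Tf : tame N f f'.
Implicit Types (gamma : R -> CC R) (p q : CC R).

Lemma induced_length_ge_dist gamma p q : path_in N p q gamma ->
  ((cmod (q - p))%:E <= induced_length (graph f) gamma)%E.
Proof.
move=> pg; have Tid : tame N id (fun=> 1).
  move=> r r0; exists (`|B0| + 1) => z w rz rw; split.
  - rewrite (le_trans (NB (far_N NC r0 rz)))// (le_trans (ler_norm _))//.
    by rewrite lerDl.
  - by rewrite cmod1 lerDr.
  - by rewrite mul1r subrr cmod0 mulr_ge0 ?sqr_ge0 ?addr_ge0.
have [_ _ _ <-] := pg.
apply: (induced_length_ge oN NC Tf Tid _ pg); last by rewrite in_itv /= ler01 lexx.
move=> z v Nz; rewrite (graph_induced_norm oN NC Tf)// mul1r.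
by rewrite -[leLHS]ger0_norm ?cmod_ge0// -sqrtr_sqr ler_wsqrtr// lerDl sqr_ge0.
Qed.

Lemma induced_length_ge_osc gamma p q t : path_in N p q gamma ->
  t \in `[0, 1] ->
  ((cmod (f (gamma t) - f p))%:E <= induced_length (graph f) gamma)%E.
Proof.
move=> pg t01; apply: (induced_length_ge oN NC Tf Tf _ pg t01).
move=> z v Nz; rewrite (graph_induced_norm oN NC Tf)// [f' z * v]mulrC.
by rewrite -[leLHS]ger0_norm ?cmod_ge0// -sqrtr_sqr ler_wsqrtr// lerDr sqr_ge0.
Qed.

Let line p q (t : R) : CC R := p + t%:C * (q - p).

Let line_derive p q t :
  is_derive t (1 : R) (@complex.Re R \o line p q) (complex.Re (q - p)) /\
  is_derive t (1 : R) (@complex.Im R \o line p q) (complex.Im (q - p)).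
Proof.
have H (a b : R) : is_derive t (1 : R) (fun s => a + s * b) b.
  by apply: is_derive_eq; rewrite add0r mul1r scaler0 add0r /GRing.scale /= mulr1.
split.
  rewrite (_ : _ \o _ = fun s => complex.Re p + s * complex.Re (q - p)) //.
  by apply/funext => s; rewrite /line /=; case: p q => [? ?] [? ?] /=; ring.
rewrite (_ : _ \o _ = fun s => complex.Im p + s * complex.Im (q - p)) //.
by apply/funext => s; rewrite /line /=; case: p q => [? ?] [? ?] /=; ring.
Qed.

Let line_velocity p q t : velocity (line p q) t = q - p.
Proof.
have [[_ H1] [_ H2]] := line_derive p q t.
by rewrite /velocity !derive1E H1 H2; case: (q - p).
Qed.

Let line_continuous p q : continuous (line p q).
Proof.
move=> t P /near_cmodP[e e0 HP].
have d0 : 0 < cmod (q - p) + 1 by rewrite ltr_wpDl ?cmod_ge0.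
apply/nbhs_ballP; exists (e / (cmod (q - p) + 1)) => /=; first exact: divr_gt0.
move=> s; rewrite -ball_normE /= distrC ltr_pdivlMr// => H; apply: HP.
have -> : line p q s - line p q t = (s - t)%:C * (q - p).
  by rewrite /line rmorphB /=; ring.
by rewrite cmodM cmodR (le_lt_trans _ H)// ler_wpM2l// lerDl.
Qed.

Let line_C1 p q : C1_on (line p q) 0 1.
Proof.
split; first by move=> t _; have [[? _] [? _]] := line_derive p q t.
exists (fun=> q - p); split; first by apply: continuous_subspaceT => t; exact: cvg_cst.
by move=> t _; rewrite line_velocity.
Qed.

Let line_path p q : (forall t, t \in `[0, 1] -> N (line p q t)) ->
  path_in N p q (line p q).
Proof.
move=> HN; split => //; last 2 first.
- by rewrite /line mul0r addr0.
- by rewrite /line mul1r addrC subrK.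
split; first by apply: continuous_subspaceT; exact: line_continuous.
exists [:: 1]; split => //=; first by rewrite ltr01.
by move=> [|//] _; exact: line_C1.
Qed.

(** The straight segment is a competitor. Its speed is |q - p| sqrt(1 + |f'|^2), and 1 + sup |f'|
    bounds the root; this gives [K]. *)
Lemma induced_dist_local p : N p -> exists K e, [/\ 0 < K, 0 < e &
  forall q, cmod (q - p) < e ->
    (induced_dist N (graph f) q p <= (K * cmod (q - p))%:E)%E].
Proof.
move=> Np; have [M [e [M0 e0 H]]] := tame_local oN NC Tf Np.
pose K := 1 + (cmod (f' p) + M * e).
have K0 : 0 < K by rewrite /K ltr_wpDr ?addr_ge0 ?cmod_ge0// mulr_ge0// ltW.
exists K, e; split => // q qe.
have near_p t : t \in `[0, 1] -> cmod (line q p t - p) < e.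
  rewrite in_itv /= => /andP[t0 t1].
  have -> : line q p t - p = (1 - t)%:C * (q - p).
    by rewrite /line rmorphB /=; ring.
  rewrite cmodM cmodR ger0_norm; last by rewrite subr_ge0.
  by rewrite (le_lt_trans _ qe)// ler_piMl ?cmod_ge0//; lra.
have lN t : t \in `[0, 1] -> N (line q p t) by move=> /near_p/H[].
apply: (@le_trans _ _ (induced_length (graph f) (line q p))).
  by apply: ereal_inf_lbound; exists (line q p) => //; exact: line_path.
have -> : (K * cmod (q - p))%:E = (\int[lebesgue_measure]_(t in `[0%R, 1%R])
    (cst (K * cmod (q - p))%:E t))%E.
  by rewrite integral_cst//= lebesgue_measure_itv /= lte01 sube0 mule1.
have mk : measurable_fun `[(0 : R), 1] (fun t =>
    induced_norm (graph f) (line q p t) (velocity (line q p) t)).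
  apply: (@measurable_fun_itv_cc _ _ _ false true).
  apply: (@induced_norm_measurable _ _ oN NC _ _ Tf (line q p) _ _ ltr01) => //.
  by apply: continuous_subspaceT; exact: line_continuous.
apply: ge0_le_integral => //.
- by move=> t _; rewrite lee_fin sqrtr_ge0.
- exact/measurable_EFinP.
move=> t t01; rewrite lee_fin (graph_induced_norm oN NC Tf _ (lN t t01)).
rewrite line_velocity.
have [_ _ _ H4] := H _ (near_p _ t01).
have fb : cmod (f' (line q p t)) <= cmod (f' p) + M * e.
  rewrite (le_trans (cmod_subD _ (f' p)))// lerD2l (le_trans H4)//.
  by rewrite ler_wpM2l// ltW// near_p.
rewrite cmodM (cmod_distC q p).
have X0 := cmod_ge0 (p - q); have Y0 := cmod_ge0 (f' (line q p t)).
set X := cmod (p - q) in X0 *; set Y := cmod _ in fb Y0 *.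
rewrite -[leRHS]ger0_norm ?mulr_ge0 ?(ltW K0)// -sqrtr_sqr ler_wsqrtr//.
have : X * Y <= X * (cmod (f' p) + M * e) by rewrite ler_wpM2l.
have : 0 <= X * Y by rewrite mulr_ge0.
rewrite /K; set c := cmod (f' p) + M * e; move: (X * Y) => u u0 uc.
have -> : ((1 + c) * X) ^+ 2 = X ^+ 2 + (X * c) ^+ 2 + 2 * X * (X * c) by ring.
have xc : 0 <= X * c by exact: le_trans uc.
rewrite (@le_trans _ _ (X ^+ 2 + (X * c) ^+ 2))//.
  by rewrite lerD2l lerXn2r ?nnegrE.
by rewrite lerDl mulr_ge0// mulr_ge0.
Qed.

(** Take the infimum of the times at distance at most [d], attained by continuity. The path up to
    then is a connected subset of [far N d] reaching level [d], as the barrier property demands. *)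
Lemma first_hit gamma d : {within `[0, 1], continuous gamma} ->
  d < bdist N (gamma 0) -> bdist N (gamma 1) <= d ->
  exists t1, [/\ t1 \in `[0, 1], bdist N (gamma t1) <= d &
    forall t, t \in `[0, t1] -> d <= bdist N (gamma t)].
Proof.
move=> cg d0 d1; pose beta t := bdist N (gamma t).
have cb : {within `[0, 1], continuous beta}.
  apply/subspace_continuousP => t t01; move/subspace_continuousP/(_ t t01): cg => H.
  exact: (continuous_cvg _ (@bdist_continuous R N NC _) H).
pose K := [set t | t \in `[(0 : R), 1] /\ beta t <= d].
have K1 : K 1 by split => //; rewrite in_itv /= ler01 lexx.
have Klb : lbound K 0 by move=> t [+ _]; rewrite in_itv /= => /andP[].
have hinf : has_inf K by split; [exists 1|exists 0].
pose t1 := inf K.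
have t10 : 0 <= t1 by apply: lb_le_inf => //; exists 1.
have t11 : t1 <= 1 by apply: ge_inf => //; exists 0.
have t1in : t1 \in `[0, 1] by rewrite in_itv /= t10.
have bt1 : beta t1 <= d.
  rewrite leNgt; apply/negP => dt1.
  move/subspace_continuousP/(_ t1 t1in): cb => H.
  have : \forall t \near within `[0, 1] (nbhs t1), d < beta t by exact: (cvgr_gt _ H).
  move=> /nbhs_ballP[e /= e0 He].
  have [t [t01 td] tt] := inf_adherent e0 hinf.
  have t1t : t1 <= t by apply: ge_inf; [exists 0|split].
  have : d < beta t.
    apply: He => //; rewrite -ball_normE /= distrC ger0_norm ?subr_ge0//.
    by rewrite ltrBlDl.
  by rewrite ltNge td.
exists t1; split => // t; rewrite in_itv /= => /andP[t0 tt1].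
have t01 : t \in `[0, 1] by rewrite in_itv /= t0 (le_trans tt1).
rewrite leNgt; apply/negP => btd.
(* A value below [d] at some t <= t1 would force the value [d] strictly earlier; this covers t = t1
   as well. *)
have [c cin bc] : exists2 c, c \in `[0, t] & beta c = d.
  apply: IVT => //.
    apply: continuous_subspaceW cb => r /=; rewrite !in_itv /= => /andP[-> rt].
    by rewrite (le_trans rt)// (le_trans tt1).
  by rewrite ge_min le_max (ltW d0) (ltW btd) orbT.
have ct : c < t.
  move: cin; rewrite in_itv /= => /andP[_]; rewrite le_eqVlt => /orP[/eqP ct|//].
  by move: btd; rewrite -ct -/(beta c) bc ltxx.
have : t1 <= c.
  apply: ge_inf; first by exists 0.
  split; last by rewrite bc.
  move: cin; rewrite !in_itv /= => /andP[-> ct']; rewrite (le_trans ct')//.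
  by rewrite (le_trans tt1).
by rewrite leNgt (lt_le_trans ct).
Qed.

Lemma induced_dist_ge0 p q : (0 <= induced_dist N (graph f) p q)%E.
Proof.
apply: le_ereal_inf_tmp => _ [gamma _ <-].
by apply: integral_ge0 => t _; rewrite lee_fin sqrtr_ge0.
Qed.

Hypothesis barrier : forall q A, N q -> exists d, [/\ 0 < d, d < bdist N q &
  forall S z, connected S -> S `<=` far N d -> S q -> S z ->
    bdist N z <= d -> exists2 w, S w & A <= cmod (f w)].

(** Induced length dominates Euclidean distance, so the sequence has a limit in the plane. Inside
    [N] the local bound gives convergence; outside [N] the barrier gives a contradiction. *)
Lemma graph_complete : complete_on N (graph f).
Proof.
move=> u uN uC.
have short e m n : (induced_dist N (graph f) (u m) (u n) < e)%E ->
    exists2 gamma, path_in N (u m) (u n) gamma &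
      (induced_length (graph f) gamma < e)%E.
  by move=> /ereal_inf_lt[_ [gamma pg <-]] ge; exists gamma.
have [|p Hp] := @complex_cauchy R u.
  move=> e /uC[M HM]; exists M => m n Mm Mn.
  have [gamma pg ge] := short _ _ _ (HM n m Mn Mm).
  by rewrite -lte_fin (le_lt_trans (induced_length_ge_dist pg)).
have [Np|nNp] := pselect (N p).
  exists p => //; have [K [e [K0 e0 HK]]] := induced_dist_local Np.
  have up0 : (K * cmod (u n - p))%:E @[n --> \oo] --> 0%E.
    apply: cvg_EFin; first exact: nearW.
    apply/cvgrPdist_lt => r r0.
    have [M HM] := Hp (r / K) (divr_gt0 r0 K0).
    exists M => // n /= Mn; rewrite sub0r normrN ger0_norm; last first.
      by rewrite mulr_ge0 ?cmod_ge0// ltW.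
    by rewrite mulrC -ltr_pdivlMr// HM.
  apply: (squeeze_cvge _ (@cvg_cst _ 0%E _ _ _) up0).
  have [M HM] := Hp e e0; exists M => // n /= Mn.
  by rewrite induced_dist_ge0 HK// HM.
(* A path of length below 1 from [u M] keeps |f| below |f (u M)| + 1, while the barrier yields a
   point violating this before the path gets close to the boundary limit. *)
exfalso; have [M HM] := uC 1 ltr01.
have [d [d0 dq Hd]] := barrier (cmod (f (u M)) + 1) (uN M).
have [M' HM'] := Hp d d0.
pose n := maxn M M'.
have [gamma pg gl] := short _ _ _ (HM M n (leqnn _) (leq_maxl _ _)).
have un : bdist N (u n) <= d.
  by rewrite (le_trans (bdist_le NC _ nNp))// ltW// HM'// leq_maxr.
have [[cg _] gN g0 g1] := pg.
have dg0 : d < bdist N (gamma 0) by rewrite g0.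
have dg1 : bdist N (gamma 1) <= d by rewrite g1.
have [t1 [t1in bt1 Ht1]] := first_hit cg dg0 dg1.
have sub1 : `[0, t1] `<=` `[(0 : R), 1].
  move: t1in; rewrite in_itv /= => /andP[_ t11] t /=; rewrite !in_itv /=.
  by move=> /andP[-> /le_trans ->].
have t10 : 0 <= t1 by move: t1in; rewrite in_itv /= => /andP[].
have [|||||_ [t t01 <-]] := Hd (gamma @` `[0, t1]) (gamma t1).
- apply: connected_continuous_connected; first exact: segment_connected.
  exact: continuous_subspaceW sub1 cg.
- by move=> _ [t tin <-]; exact: Ht1.
- by exists 0; rewrite ?g0//= in_itv /= lexx.
- by exists t1; rewrite //= in_itv /= lexx t10.
- exact: bt1.
apply/negP; rewrite -ltNge.
have := le_lt_trans (induced_length_ge_osc pg (sub1 _ t01)) gl.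
by rewrite lte_fin; have := cmod_subD (f (gamma t)) (f (u M)); lra.
Qed.

Hypothesis returns : forall d, 0 < d -> exists p,
  [/\ N p, bdist N p <= d & cmod (f p) <= 4].

(** The preimage of a product of two squares contains points of [N] arbitrarily near the complement.
    Were it compact, its image under [bdist] would be closed and contain 0, yet [bdist] is positive
    on [N]. *)
Lemma graph_not_proper : ~ proper_on N (graph f).
Proof.
move=> pr.
pose Q (B : R) := [set z : CC R | `|complex.Re z| <= B /\ `|complex.Im z| <= B].
have QP B z : cmod z <= B -> Q B z.
  by move=> zB; split; [rewrite (le_trans (Re_le_cmod _))|
                        rewrite (le_trans (Im_le_cmod _))].
have cK : compact (N `&` graph f @^-1` (Q B0 `*` Q 4)).
  by apply: pr; apply: compact_setX; exact: csquare_compact.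
have cI : compact (bdist N @` (N `&` graph f @^-1` (Q B0 `*` Q 4))).
  apply: continuous_compact cK; apply: continuous_subspaceT.
  exact: bdist_continuous.
have clI := compact_closed (@Rhausdorff R) cI.
have : closure (bdist N @` (N `&` graph f @^-1` (Q B0 `*` Q 4))) 0.
  move=> P /nbhs_ballP[e /= e0 HP].
  have e2 : 0 < e / 2 by rewrite divr_gt0.
  have [p [Np pe fp]] := returns e2.
  exists (bdist N p); split.
    exists p => //; split => //; split; apply: QP => //=; exact: NB.
  apply: HP; rewrite -ball_normE /= sub0r normrN ger0_norm ?bdist_ge0//.
  by rewrite (le_lt_trans pe)//; lra.
move=> /clI[z [Nz _] z0].
by have := bdist_gt0 NC oN Nz; rewrite z0 ltxx.
Qed.

End Completeness.

Theorem corollary4p7 (R : realType) (N : set (CC R)) :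
  domain N -> bounded_set N ->
  exists F : CC R -> CC R * CC R,
    [/\ holomorphic_embedding N F, complete_on N F & ~ proper_on N F].
Proof.
move=> [N0 oN _] bN.
have [B NB] : exists B, forall z, N z -> cmod z <= B.
  case: bN => M [Mr HM]; exists (complex.Re (M + 1)) => z Nz.
  have := HM (M + 1); rewrite ltrDl ltr01 => /(_ isT) /= /(_ z Nz).
  by rewrite normE lecE => /andP[_].
have NC : ~` N !=set0.
  exists ((`|B| + 1)%:C : CC R) => /NB; rewrite cmodR ger0_norm ?addr_ge0//.
  by have := ler_norm B; lra.
have [f [f' [Tf barrier returns]]] := barrier_function oN NC N0 NB.
exists (graph f); split.
- exact: (graph_embedding oN NC Tf).
- exact: (graph_complete oN NC NB Tf barrier).
- exact: (graph_not_proper oN NC NB returns).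
Qed.
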